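(* Let $\ell \neq f$ be primes, let $\mathbf{F}_q$ be a finite field with $q \equiv 1 \pmod{\ell f}$, let $g$ be a generator of $\mathbf{F}_q^\times$, let $L = \mathbf{Q}(\zeta_{\ell f})$ with $\zeta_{\ell f}$ a primitive $\ell f$-th root of unity in $\overline{\mathbf{Q}}$, let $\mathcal{O}_L = \mathbf{Z}[\zeta_{\ell f}]$, and let $\pi_\ell = \zeta_{\ell f}^{f} - 1 \in \mathcal{O}_L$. Let $\chi : \mathbf{F}_q^\times \to L^\times$ be a character of order $\ell f$ and let $J(\ell, f) = \sum_{x \in \mathbf{F}_q \setminus \{0,1\}} \chi^{\ell}(x)\chi^{f}(1-x) \in \mathcal{O}_L$. Let $\xi_\ell, \xi_f \in \mathbf{F}_q^\times$ be the roots of unity defined in the context. Then the following are equivalent: (1) $J(\ell, f) + 1 \in \pi_\ell^{\ell} \mathcal{O}_L$; (2) $q \equiv 1 \pmod{\ell^2 f}$ and $1 - \xi_\ell^{i}\xi_f^{j} \in \mathbf{F}_q^{\times \ell}$ for all $i \in [0, \ell-1]$ and $j \in [1, f-1]$; (3) $q \equiv 1 \pmod{\ell^2 f}$ and $1 - \xi_\ell^{i}\xi_f^{j} \in \mathbf{F}_q^{\times \ell}$ for all $i \in [0, \ell-1]$ and $j \in [1, f/2]$.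
   Context: Intervals $[a,b]$ denote the set of integers $n$ with $a \le n \le b$. $\mathbf{F}_q^{\times \ell}$ denotes the subgroup of $\ell$-th powers in $\mathbf{F}_q^\times$. In $\mathbf{F}_q^\times$, put $\bar\zeta_{\ell f} = g^{(q-1)/(\ell f)}$ (a primitive $\ell f$-th root of unity in $\mathbf{F}_q$); $\xi_\ell \in \mathbf{F}_q^\times$ is the unique $\ell$-th root of unity with $\xi_\ell^{f} = \bar\zeta_{\ell f}^{\,f}$, and $\xi_f \in \mathbf{F}_q^\times$ is the unique $f$-th root of unity with $\xi_f^{\ell} = \bar\zeta_{\ell f}^{\,\ell}$. *)

(* Defs.v *)
From mathcomp Require Import all_boot all_order all_algebra all_fingroup.
From mathcomp Require Import all_solvable all_field.

Set Implicit Arguments.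
Unset Strict Implicit.
Unset Printing Implicit Defensive.

Import GRing.Theory.
Local Open Scope ring_scope.

(* The subring Z[z] of K. *)
Definition Zadjoin (K : fieldType) (z x : K) : Prop :=
  exists p : {poly int}, x = (map_poly intr p).[z].

(* As K is a field, these are the group morphisms from F^* to K^*. *)
Definition mult_character (F : finFieldType) (K : fieldType)
    (chi : {unit F} -> K) : Prop :=
  chi 1%g = 1 /\ {morph chi : u v / (u * v)%g >-> u * v}.

Definition character_order (F : finFieldType) (K : fieldType)
    (chi : {unit F} -> K) (n : nat) : Prop :=
  [/\ (0 < n)%N,
      forall u, chi u ^+ n = 1
    & forall m, (0 < m)%N -> (forall u, chi u ^+ m = 1) -> (n <= m)%N].

(* The element of F^* given by a nonzero x; the junk value at 0 is 1. *)
Definition to_unit (F : finFieldType) (x : F) : {unit F} := insubd (1%g : {unit F}) x.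

Definition jacobi_sum (F : finFieldType) (K : fieldType)
    (chi : {unit F} -> K) (a b : nat) : K :=
  \sum_(x : F | (x != 0) && (x != 1))
     chi (to_unit x) ^+ a * chi (to_unit (1 - x)) ^+ b.

(* The subgroup of n-th powers of F^*, as a subset of F. *)
Definition unit_powers (F : finFieldType) (n : nat) : {set F} :=
  [set val (u ^+ n)%g | u : {unit F}].

(* Main.v *)
Require Import Defs.
From mathcomp Require Import all_boot all_order all_algebra all_fingroup.
From mathcomp Require Import all_solvable all_field.
From mathcomp Require Import ring zify.

(** Write [q = #|F|], [d] for the discrete logarithm to base [g], [z], [v] for
    primitive [f]-th and [l]-th roots of unity, and [n i j] for the coefficients
    of [J + 1 = sum_(i < l, j < f) n i j * z^j * v^i] obtained by sorting the
    terms of the Jacobi sum.  The sums [sum_i n i j] do not depend on [j], and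
    the only relations between the [z^j v^i] over [Z] come from [sum_j z^j = 0]
    and [sum_i v^i = 0]; as [(v - 1)^l] is associate to [l (v - 1)], condition
    (1) says that [n i j] mod [l] does not depend on [j].  It forces
    [l^2 | q - 1] through [J * conj J = q].

    Now let [v] and [z] live in the ring [B = F_l[X, Y]/(1 + ... + X^(f-1), Y^l - 1)],
    where (1) becomes [J = -1].  For any function [c], the cocycle identity of
    Jacobi sums relates the sums of [z^d(x) v^d(1-x)] and [z^d(x) v^d(x) c(1-x)]
    to those with the first character removed.  Taking [c = d], a derivation in
    the variable [Y] shows that [J = -1] if and only if
    [sum_x (z^d(x) - 1) v^d(x) d(1-x) = 0] in [B].  The coefficients of the latter
    are the sums of [d(1-x)] over the classes modulo [(l f)]-th powers, and the
    product of [1 - x] over such a class is [1 - xi_l^i xi_f^j]. *)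

Set Implicit Arguments.
Unset Strict Implicit.
Unset Printing Implicit Defensive.
Import GRing.Theory.
Local Open Scope ring_scope.

(** * Sums over the powers of two roots of unity *)

Definition bisum (B : nzRingType) (l f : nat) (z v : B) (c : nat -> nat -> int) : B :=
  \sum_(i < l) \sum_(j < f) (c i j)%:~R * z ^+ j * v ^+ i.

Lemma eq_bisum (B : nzRingType) (l f : nat) (z v : B) (c c' : nat -> nat -> int) :
  (forall i j, (i < l)%N -> (j < f)%N -> c i j = c' i j) ->
  bisum l f z v c = bisum l f z v c'.
Proof. by move=> e; apply: eq_bigr => i _; apply: eq_bigr => j _; rewrite e. Qed.

Lemma bisumD (B : nzRingType) (l f : nat) (z v : B) (c c' : nat -> nat -> int) :
  bisum l f z v (fun i j => c i j + c' i j) = bisum l f z v c + bisum l f z v c'.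
Proof.
rewrite /bisum -big_split; apply: eq_bigr => i _; rewrite -big_split.
by apply: eq_bigr => j _; rewrite intrD !mulrDl.
Qed.

Lemma bisumZ (B : nzRingType) (l f : nat) (z v : B) (t : int) (c : nat -> nat -> int) :
  bisum l f z v (fun i j => t * c i j) = t%:~R * bisum l f z v c.
Proof.
rewrite /bisum mulr_sumr; apply: eq_bigr => i _; rewrite mulr_sumr.
by apply: eq_bigr => j _; rewrite intrM !mulrA.
Qed.

Lemma bisumB (B : nzRingType) (l f : nat) (z v : B) (c c' : nat -> nat -> int) :
  bisum l f z v (fun i j => c i j - c' i j) = bisum l f z v c - bisum l f z v c'.
Proof.
rewrite -mulN1r -(@bisumZ _ _ _ _ _ (-1)) -bisumD.
by apply: eq_bisum => i j _ _; rewrite mulN1r.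
Qed.

Lemma bisum_delta (B : nzRingType) (l f : nat) (z v : B) i0 j0 :
  (i0 < l)%N -> (j0 < f)%N ->
  bisum l f z v (fun i j => (((i == i0) && (j == j0)) : nat)%:Z) = z ^+ j0 * v ^+ i0.
Proof.
move=> hi hj; rewrite /bisum (bigD1 (Ordinal hi)) //= (bigD1 (Ordinal hj)) //=.
rewrite !eqxx mul1r big1 ?addr0 => [|j nj].
  rewrite big1 ?addr0 // => i ni; apply: big1 => j _.
  by move: ni; rewrite -val_eqE /= => /negbTE ->; rewrite !mul0r.
by move: nj; rewrite -val_eqE /= => /negbTE ->; rewrite !mul0r.
Qed.

Lemma bisum_rows (B : nzRingType) (l f : nat) (z v : B) (r : nat -> int) :
  \sum_(j < f) z ^+ j = 0 -> bisum l f z v (fun i _ => r i) = 0.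
Proof.
move=> hz; apply: big1 => i _; rewrite -mulr_suml.
by rewrite -mulr_sumr hz mulr0 mul0r.
Qed.

Lemma bisum_partition (B : nzRingType) (l f : nat) (z v : B) (I : finType)
    (P : pred I) (w : I -> int) (d e : I -> nat) :
  (0 < l)%N -> (0 < f)%N -> z ^+ f = 1 -> v ^+ l = 1 ->
  \sum_(x | P x) (w x)%:~R * z ^+ d x * v ^+ e x =
  bisum l f z v
    (fun i j => \sum_(x | [&& P x, e x %% l == i & d x %% f == j]%N) w x).
Proof.
move=> l0 f0 zf vl.
rewrite (partition_big (fun x => Ordinal (ltn_pmod (e x) l0)) xpredT) //=.
apply: eq_bigr => i _.
rewrite (partition_big (fun x => Ordinal (ltn_pmod (d x) f0)) xpredT) //=.
apply: eq_bigr => j _.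
rewrite raddf_sum !mulr_suml; apply: eq_big => [x|x].
  by rewrite -!val_eqE /= andbA.
rewrite -!val_eqE /= => /andP[/andP[_ /eqP <-] /eqP <-].
by rewrite !expr_mod.
Qed.

(** Subtracting the multiple of [1 + X + ... + X^(f-1)] with the same top coefficient brings the
    degree below [f - 1], so the difference is its own remainder modulo that polynomial. *)
Lemma poly_const_coef (R : nzRingType) (f : nat) (c : nat -> R) :
  (size (\poly_(j < f) c j - c f.-1 *: \poly_(j < f) (1 : R))%R <= f.-1)%N.
Proof.
apply/leq_sizeP => j hj; rewrite coefB coefZ !coef_poly.
case: ltnP => hf; last by rewrite mulr0 subrr.
have -> : j = f.-1 by move: hj hf; lia.
by rewrite mulr1 subrr.
Qed.

Lemma poly_const_coef_eq0 (R : nzRingType) (f : nat) (c : nat -> R) :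
  \poly_(j < f) c j - c f.-1 *: \poly_(j < f) (1 : R) = 0 ->
  forall j, (j < f)%N -> c j = c 0.
Proof.
move=> e0; have e : forall j, (j < f)%N -> c j = c f.-1.
  move=> j hj; have /(congr1 (fun p : {poly R} => p`_j)) := e0.
  by rewrite coefB coefZ !coef_poly hj coef0 mulr1 => /eqP; rewrite subr_eq0 => /eqP.
by move=> j hj; rewrite (e j) // (e 0) //; apply: leq_ltn_trans hj.
Qed.

(** The polynomial of [poly_const_coef] vanishes at the [f - 1] distinct points [z^a] with
    [0 < a < f], too many for its degree unless it is zero. *)
Lemma const_of_prim_roots (K : idomainType) (f : nat) (z : K) (c : nat -> K) :
  prime f -> f.-primitive_root z ->
  (forall a, (0 < a < f)%N -> \sum_(j < f) c j * z ^+ (a * j) = 0) ->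
  forall j, (j < f)%N -> c j = c 0.
Proof.
move=> fP zP hc; apply: poly_const_coef_eq0; apply/eqP/negPn/negP => nz.
set p := (X in X != 0) in nz.
pose rs := [seq z ^+ a | a <- iota 1 f.-1].
have f1 := prime_gt1 fP.
have : (size rs < size p)%N.
  apply: (max_poly_roots nz).
    apply/allP => x /mapP[a]; rewrite mem_iota => ha0 ->.
    have ha : (0 < a < f)%N by clear -ha0 f1; lia.
    have hs : \sum_(j < f) z ^+ (a * j) = 0.
      have : z ^+ a - 1 != 0.
        rewrite subr_eq0 -(prim_order_dvd zP) gtnNdvd //; first by case/andP: ha.
        by case/andP: ha.
      move=> /mulfI; apply; rewrite mulr0.
      under eq_bigr do rewrite exprM.
      by rewrite -subrX1 exprAC (prim_expr_order zP) expr1n subrr.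
    rewrite rootE hornerD hornerN hornerZ !horner_poly.
    under eq_bigr do rewrite -exprM.
    rewrite hc // sub0r oppr_eq0.
    under eq_bigr do rewrite -exprM mul1r.
    by rewrite hs mulr0.
  rewrite map_inj_in_uniq ?iota_uniq // => a b.
  rewrite !mem_iota => ha hb /eqP; rewrite (eq_prim_root_expr zP).
  by rewrite !modn_small => [/eqP||]; lia.
rewrite size_map size_iota ltnNge => /negP; apply.
exact: poly_const_coef.
Qed.

Lemma in_qpoly_modulus (R : comNzRingType) (h : {poly R}) :
  (1 < size h)%N -> h \is monic -> in_qpoly h h = 0.
Proof.
by move=> h1 hM; apply: val_inj; rewrite /= /mk_monic h1 hM Pdiv.RingMonic.rmodpp.
Qed.

(* [B = F_l[X, Y] / (1 + X + ... + X^(f-1), Y^l - 1)], with [z = X] and [v = Y]. *)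
Lemma modular_bisum_ring (l f : nat) : prime l -> prime f ->
  exists (B : comNzRingType) (z v : B),
  [/\ (l%:R = 0 :> B), \sum_(j < f) z ^+ j = 0, z ^+ f = 1, v ^+ l = 1 &
    forall c, bisum l f z v c = 0 ->
      forall i j, (i < l)%N -> (j < f)%N -> (l %| c i j - c i 0%N)%Z].
Proof.
move=> lP fP; have f1 := prime_gt1 fP; have l1 := prime_gt1 lP.
pose h : {poly 'F_l} := \poly_(j < f) 1.
have hS : size h = f by apply: size_poly_eq; rewrite oner_eq0.
have hM : h \is monic.
  by rewrite monicE lead_coefE hS coef_poly prednK ?leqnn // prime_gt0.
(* [{poly %/ h}] divides by [mk_monic h], which falls back to another polynomial unless [h] is monic
   and nonconstant. *)
have hE : mk_monic h = h by rewrite /mk_monic hS f1 hM.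
pose R1 := {poly %/ h}; pose z : R1 := in_qpoly h 'X.
have hZ : \sum_(j < f) z ^+ j = 0.
  under eq_bigr do rewrite -rmorphXn /=.
  rewrite -raddf_sum /=.
  have -> : \sum_(j < f) 'X^j = h.
    by rewrite /h poly_def; apply: eq_bigr => j _; rewrite scale1r.
  by rewrite in_qpoly_modulus ?hS.
have zf : z ^+ f = 1.
  by apply/eqP; rewrite -subr_eq0 subrX1 hZ mulr0.
pose k : {poly R1} := 'X^l - 1.
have kS : size k = l.+1 by rewrite /k -[1]/(1%:P) size_XnsubC // prime_gt0.
have kM : k \is monic by apply: monicXnsubC; exact: prime_gt0.
have kE : mk_monic k = k by rewrite /mk_monic kS ltnS prime_gt0 // kM.
pose B := {poly %/ k}; pose v : B := in_qpoly k 'X.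
have l0 : (l%:R = 0 :> R1).
  have : l \in [pchar R1] by rewrite pchar_qpoly pchar_Fp.
  by move/andP => [_ /eqP].
exists B, (in_qpoly k z%:P), v; split.
- by rewrite -(rmorph_nat (in_qpoly k \o polyC)) l0 /= !raddf0.
- have -> : \sum_(j < f) in_qpoly k z%:P ^+ j =
      (in_qpoly k \o polyC) (\sum_(j < f) z ^+ j).
    by rewrite rmorph_sum; apply: eq_bigr => j _; rewrite -2!rmorphXn.
  by rewrite hZ /= !raddf0.
- by rewrite -2!rmorphXn zf /= !rmorph1.
- apply/eqP; rewrite -subr_eq0 -(rmorph1 (in_qpoly k)) -rmorphXn -raddfB /=.
  by rewrite -/k in_qpoly_modulus // kS ltnS prime_gt0.
move=> c; have -> : bisum l f (in_qpoly k z%:P) v c =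
    in_qpoly k (\poly_(i < l) \sum_(j < f) (c i j)%:~R * z ^+ j).
  rewrite poly_def rmorph_sum; apply: eq_bigr => i _ /=.
  rewrite -mul_polyC rmorphM rmorphXn /= rmorph_sum rmorph_sum mulr_suml.
  apply: eq_bigr => j _ /=; rewrite !rmorphM !rmorphXn /=; congr (_ * _ * _).
  by rewrite !rmorph_int.
move=> /(congr1 val) /= ; rewrite Pdiv.CommonRing.rmodp_small; last first.
  by rewrite kE kS ltnS size_poly.
move=> e0 i j hi hj.
have {e0} : \sum_(j < f) (c i j)%:~R * z ^+ j = 0.
  by have /(congr1 (fun p : {poly R1} => p`_i)) := e0; rewrite coef_poly hi coef0.
have -> : \sum_(j < f) (c i j)%:~R * z ^+ j =
    in_qpoly h (\poly_(j < f) (c i j)%:~R).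
  rewrite poly_def rmorph_sum; apply: eq_bigr => u _ /=.
  by rewrite -mul_polyC rmorphM rmorphXn /= !rmorph_int.
have hh : in_qpoly h h = 0 by rewrite in_qpoly_modulus ?hS.
move=> e0; have := @poly_const_coef_eq0 _ f (fun j => (c i j)%:~R : 'F_l) _ j hj.
move=> cE; suff : (c i j)%:~R = (c i 0%N)%:~R :> 'F_l.
  move/eqP; rewrite -subr_eq0 -intrB => /eqP e1.
  have := @dvdz_pcharf 'F_l l (pchar_Fp lP) (c i j - c i 0%N).
  by rewrite e1 eqxx.
(* A polynomial of degree [f - 1] need not be reduced modulo [h]; [p] differs from it by a multiple
   of [h] and is reduced. *)
apply: cE; set p := (X in X = 0).
have : in_qpoly h p = 0 by rewrite /p raddfB /= -mul_polyC rmorphM /= e0 hh mulr0 subrr.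
move=> /(congr1 val) /=; rewrite Pdiv.CommonRing.rmodp_small // hE hS.
by rewrite (leq_ltn_trans (poly_const_coef _ _)) // ltn_predL prime_gt0.
Qed.

(** * Discrete logarithms and Jacobi sums *)

Section DiscreteLog.
Variables (F : finFieldType) (g : F).
Hypothesis g_prim : (#|F|.-1).-primitive_root g.

(* [dlog 0 = 0], as no power of [g] vanishes. *)
Definition dlog (x : F) : nat :=
  if [pick k : 'I_#|F|.-1 | g ^+ k == x] is Some k then k else 0.

Lemma prim_neq0 : g != 0.
Proof.
apply/eqP => g0; have := prim_expr_order g_prim; rewrite g0 expr0n.
by rewrite gtn_eqF ?(prim_order_gt0 g_prim) // => /esym/eqP; rewrite oner_eq0.
Qed.

Lemma dlogK x : x != 0 -> g ^+ dlog x = x.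
Proof.
move=> x0; rewrite /dlog; case: pickP => [k /eqP //|].
have xq : x ^+ #|F|.-1 = 1.
  apply: (mulfI x0); rewrite mulr1 -exprS prednK ?expf_card //.
  by apply/card_gt0P; exists 0.
by have [i -> /(_ i)] := prim_rootP g_prim xq; rewrite eqxx.
Qed.

Lemma dlog_exp k : dlog (g ^+ k) = k %[mod #|F|.-1].
Proof.
by apply/eqP; rewrite -(eq_prim_root_expr g_prim) dlogK // expf_neq0 // prim_neq0.
Qed.

Lemma dlog1 : dlog 1 = 0.
Proof.
rewrite /dlog; case: pickP => [k /eqP e|//].
have := eq_prim_root_expr g_prim k 0; rewrite e eqxx mod0n modn_small //.
by move/esym/eqP.
Qed.

Lemma dlog0 : dlog 0 = 0.
Proof.
rewrite /dlog; case: pickP => [k|//].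
by rewrite expf_eq0 (negbTE prim_neq0) andbF.
Qed.

Lemma dlogM x y : x != 0 -> y != 0 ->
  dlog (x * y) = dlog x + dlog y %[mod #|F|.-1].
Proof.
by move=> x0 y0; rewrite -[in dlog _](dlogK x0) -[in dlog _](dlogK y0) -exprD dlog_exp.
Qed.

Lemma modn_dvd_eq n m a b : (m %| n)%N -> a = b %[mod n] -> a = b %[mod m].
Proof. by move=> mn ab; rewrite -(modn_dvdm a mn) ab modn_dvdm. Qed.

(** Multiplication by [g^k] permutes [F^*] and carries class 0 to class [k], so the [n] classes have
    equal size. *)
Lemma card_dlog_class n j : (n %| #|F|.-1)%N -> (j < n)%N ->
  #|[pred x : F | (x != 0) && (dlog x %% n == j)%N]| = (#|F|.-1 %/ n)%N.
Proof.
move=> nq jn; have n0 : (0 < n)%N by apply: leq_ltn_trans jn.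
pose C j := #|[pred x : F | (x != 0) && (dlog x %% n == j)%N]|.
have CE k : (k < n)%N -> C k = C 0.
  move=> kn; rewrite /C -!sum1_card.
  have gk : g ^+ k != 0 by rewrite expf_neq0 // prim_neq0.
  rewrite (reindex_inj (mulIf gk)); apply: eq_bigl => x /=; rewrite !inE.
  rewrite mulf_eq0 (negbTE gk) orbF; case: (altP eqP) => //= x0.
  have /(modn_dvd_eq nq) := dlogM x0 gk; rewrite -[X in _ = X](modnDmr).
  rewrite (modn_dvd_eq nq (dlog_exp k)) modnDmr => ->.
  rewrite -[in LHS](modn_small kn) modnDmr -[X in (_ == X %[mod n])%N]add0n.
  by rewrite eqn_modDr mod0n.
have : (\sum_(k < n) C k = #|F|.-1)%N.
  rewrite -card_finField_unit cardsT card_sub.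
  have -> : #|[pred x : F | x \is a GRing.unit]| = #|[pred x : F | x != 0]|.
    by apply: eq_card => x; rewrite !inE unitfE.
  rewrite -[RHS]sum1_card (partition_big (fun x => Ordinal (ltn_pmod (dlog x) n0)) xpredT) //=.
  apply: eq_bigr => k _; rewrite /C -sum1_card /=.
  by apply: eq_bigl => x; rewrite !inE.
under eq_bigr do rewrite CE //.
rewrite sum_nat_const card_ord -/(C j) CE // => <-.
by rewrite mulKn.
Qed.

(** When [z^(q-1) = 1], this is the character [g |-> z], extended by 0 so that Jacobi sums range
    over all of [F]. The ring is left general: both [L] and a ring of characteristic [l] occur. *)
Definition dlog_char (B : nzRingType) (z : B) (x : F) : B :=
  if x == 0 then 0 else z ^+ dlog x.

Lemma dlog_char0 (B : nzRingType) (z : B) : dlog_char z 0 = 0.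
Proof. by rewrite /dlog_char eqxx. Qed.

Lemma dlog_char1 (B : nzRingType) (z : B) : dlog_char z 1 = 1.
Proof. by rewrite /dlog_char oner_eq0 dlog1. Qed.

Lemma dlog_charM (B : nzRingType) (z : B) n x y : (n %| #|F|.-1)%N -> z ^+ n = 1 ->
  dlog_char z (x * y) = dlog_char z x * dlog_char z y.
Proof.
move=> nq zn; rewrite /dlog_char mulf_eq0; have [->|x0] := eqVneq x 0.
  by rewrite /= mul0r.
have [->|y0] := eqVneq y 0; first by rewrite /= mulr0.
by rewrite /= -exprD -(expr_mod _ zn) (modn_dvd_eq nq (dlogM x0 y0)) expr_mod.
Qed.

(* The substitution [(x, y) |-> (x y, y)] in the first product and
   [(x, y) |-> (x, x + y - x y)] in the double sum on the right turn both into
   sums of [a(x) b(y - x) c(1 - y)]. *)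
Lemma jacobi_cocycle (B : comNzRingType) (a b c : F -> B) :
  a 0 = 0 -> a 1 = 1 -> b 0 = 0 ->
  {morph a : x y / x * y} -> {morph b : x y / x * y} ->
  (\sum_x a x * b (1 - x)) * (\sum_y a y * b y * c (1 - y)) +
    b (-1) * c 1 * \sum_x a x * b x =
  \sum_x \sum_y a x * b (1 - x) * b y * c ((1 - x) * (1 - y)) +
    b (-1) * \sum_y b y * c y.
Proof.
move=> a0 a1 b0 aM bM.
pose S := \sum_y \sum_x a x * b (y - x) * c (1 - y).
transitivity S.
  (* The substitution in [x] needs [y] nonzero; the terms with [y = 0] give [b(-1) c(1) sum a b]. *)
  rewrite /S [RHS](bigD1 (0 : F)) //= [RHS]addrC; congr (_ + _); last first.
    rewrite mulr_sumr; apply: eq_bigr => x _.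
    by rewrite sub0r subr0 -[- x]mulN1r bM; ring.
  rewrite mulr_sumr [LHS](bigD1 (0 : F)) //= a0 !mul0r mulr0 add0r.
  apply: eq_bigr => y y0; rewrite mulr_suml [RHS](reindex_inj (mulIf y0)) /=.
  apply: eq_bigr => x _; rewrite aM.
  have -> : y - x * y = (1 - x) * y by ring.
  by rewrite bM; ring.
(* Now [x] is fixed first, and the substitution in [y] needs [x] different from 1; the terms with
   [x = 1] give [b(-1) sum b c]. *)
rewrite /S exchange_big /= [LHS](bigD1 (1 : F)) //= [LHS]addrC; congr (_ + _).
  rewrite [RHS](bigD1 (1 : F)) //=.
  rewrite [X in _ = X + _]big1 ?add0r => [|y _]; last by rewrite subrr b0 mulr0 !mul0r.
  apply: eq_bigr => x x1; have x1' : 1 - x != 0 by rewrite subr_eq0 eq_sym.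
  rewrite [LHS](reindex_inj (addrI x)) [LHS](reindex_inj (mulfI x1')) /=.
  apply: eq_bigr => y _.
  have -> : x + (1 - x) * y - x = (1 - x) * y by ring.
  have -> : 1 - (x + (1 - x) * y) = (1 - x) * (1 - y) by ring.
  by rewrite bM; ring.
have inj1 : injective (fun y : F => 1 - y) by move=> y y' /addrI/oppr_inj.
rewrite mulr_sumr [LHS](reindex_inj inj1) /=; apply: eq_bigr => y _.
have -> : 1 - y - 1 = -1 * y by ring.
have -> : 1 - (1 - y) = y by ring.
by rewrite bM a1; ring.
Qed.

(* The map [y |-> t + (1 - t) / (1 - y)], extended by [1 |-> t], is a
   permutation of [F]. *)
Lemma jacobi_norm (B : comNzRingType) (a b : F -> B) :
  a 0 = 0 -> a 1 = 1 -> b 0 = 0 -> b 1 = 1 ->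
  {morph a : x y / x * y} -> {morph b : x y / x * y} ->
  \sum_x a x = 0 -> \sum_x b x = 0 -> \sum_x a x * b x = 0 ->
  (\sum_x a x * b (1 - x)) * (\sum_x a x^-1 * b (1 - x)^-1) = #|F|%:R.
Proof.
move=> a0 a1 b0 b1 aM bM sa sb sab.
(* For [y] other than 0 and 1, the quotient takes each value except 1 and [t] exactly once; the term
   at [y = 1] is [b 0 = 0], as [0^-1 = 0]. *)
have inner t : t != 1 ->
    \sum_(y | y != 0) b ((1 - t * y) / (1 - y)) = - 1 - b t.
  move=> t1; have t1' : 1 - t != 0 by rewrite subr_eq0 eq_sym.
  have := sb.
  have inj : injective (fun y : F => t + (1 - t) * (1 - y)^-1).
    by move=> y y' /addrI/(mulfI t1')/invr_inj/addrI/oppr_inj.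
  rewrite (reindex_inj inj) /= (bigD1 (1 : F)) //=.
  rewrite subrr invr0 mulr0 addr0 => /eqP; rewrite addrC addr_eq0 => /eqP e.
  rewrite -e [X in _ = _ + X](bigD1 (0 : F)) /=; last by rewrite eq_sym oner_eq0.
  have -> : t + (1 - t) * (1 - 0)^-1 = 1 by rewrite subr0 invr1; ring.
  rewrite b1 addrA addNr add0r.
  rewrite (bigD1 (1 : F)) ?oner_neq0 //= subrr invr0 mulr0 b0 add0r.
  apply: eq_big => y; first by rewrite andbC.
  case/andP => _ y1; congr b.
  have y1' : 1 - y != 0 by rewrite subr_eq0 eq_sym.
  by field.
have -> : (\sum_x a x * b (1 - x)) * (\sum_x a x^-1 * b (1 - x)^-1) =
    \sum_t a t * \sum_(y | y != 0) b ((1 - t * y) / (1 - y)).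
  rewrite mulr_sumr (bigD1 (0 : F)) //= invr0 a0 mul0r mulr0 add0r.
  under [RHS]eq_bigr do rewrite mulr_sumr.
  rewrite exchange_big /=; apply: eq_bigr => y y0.
  rewrite mulr_suml [LHS](reindex_inj (mulIf y0)) /=; apply: eq_bigr => t _.
  rewrite aM bM; have e : a y * a y^-1 = 1 by rewrite -aM divff.
  by rewrite -[in RHS](mulr1 (a t)) -e; ring.
(* The term [t = 1] gives [q - 2]; by [inner] the others give [1 + 1], since [a] and [a b] both sum
   to [-1] away from 1. *)
rewrite (bigD1 (1 : F)) //= a1 mul1r.
have -> : \sum_(y : F | y != 0) b ((1 - 1 * y) / (1 - y)) = #|F|%:R - 2.
  rewrite (bigD1 (1 : F)) ?oner_neq0 //= mul1r subrr mul0r b0 add0r.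
  rewrite (eq_bigr (fun=> 1)) => [|y /andP[_ y1]]; last first.
    by rewrite mul1r divff // subr_eq0 eq_sym.
  have : \sum_(y : F) 1 = #|F|%:R :> B by rewrite -sum1_card natr_sum.
  rewrite (bigD1 (0 : F)) //= (bigD1 (1 : F)) ?oner_neq0 //= => <-.
  by ring.
rewrite (eq_bigr (fun t => - a t - a t * b t)) => [|t t1]; last first.
  by rewrite inner //; ring.
move: sa sab; rewrite (bigD1 (1 : F)) //= a1 => sa.
rewrite (bigD1 (1 : F)) //= a1 b1 mul1r => sab.
rewrite sumrB sumrN; set A := \sum_(i | _) a i in sa *.
set C := \sum_(i | _) _ in sab *.
transitivity (#|F|%:R - (1 + A) - (1 + C)); first by ring.
by rewrite sa sab; ring.
Qed.
End DiscreteLog.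

(** * Coefficients of Jacobi sums, sorted by residues of logarithms *)

Section JacobiCounts.
Variables (F : finFieldType) (g : F) (l f : nat).
Hypothesis g_prim : (#|F|.-1).-primitive_root g.
Hypotheses (l_prime : prime l) (f_prime : prime f) (l_neq_f : l != f).
Hypothesis lf_dvd : (l * f %| #|F|.-1)%N.

Local Notation dlog := (dlog g).
Local Notation chr := (dlog_char g).

Let l_gt0 : (0 < l)%N := prime_gt0 l_prime.
Let f_gt0 : (0 < f)%N := prime_gt0 f_prime.

Lemma coprime_lf : coprime l f.
Proof. by rewrite prime_coprime // dvdn_prime2. Qed.

Lemma dvd_l : (l %| #|F|.-1)%N. Proof. exact: dvdn_trans (dvdn_mulr _ _) lf_dvd. Qed.
Lemma dvd_f : (f %| #|F|.-1)%N. Proof. exact: dvdn_trans (dvdn_mull _ _) lf_dvd. Qed.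

(* The correction at [(0, 0)] stands for the [1] in [J + 1]. *)
Definition jcount (i j : nat) : int :=
  \sum_(x : F | [&& (x != 0) && (x != 1), (dlog (1 - x)%R %% l == i)%N & (dlog x %% f == j)%N]) 1
  + (((i == 0) && (j == 0))%N : nat)%:Z.

(** The element [x = 1] lies in the class [(0, 0)], where it contributes [dlog 0 = 0]. On the other
    classes this is, modulo [q - 1], the logarithm of the product of the [1 - x]. *)
Definition logsum (i j : nat) : int :=
  \sum_(x : F | [&& x != 0, (dlog x %% l == i)%N & (dlog x %% f == j)%N]) (dlog (1 - x))%:Z.

Lemma card_dlog_class2 i j : (i < l)%N -> (j < f)%N ->
  \sum_(x : F | [&& x != 0, (dlog x %% l == i)%N & (dlog x %% f == j)%N]) 1%:Z =
  (#|F|.-1 %/ (l * f))%N.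
Proof.
move=> hi hj; have lf0 : (0 < l * f)%N by rewrite muln_gt0 l_gt0.
rewrite -(card_dlog_class g_prim lf_dvd (ltn_pmod (chinese l f i j) lf0)).
rewrite -[RHS]natz -sum1_card natr_sum; apply: eq_bigl => x; rewrite !inE.
rewrite chinese_remainder ?coprime_lf // chinese_modl ?chinese_modr ?coprime_lf //.
by rewrite !(modn_small hi) !(modn_small hj).
Qed.

Lemma dlog_char_mul_partition (B : comNzRingType) (z v : B) (w : F -> int) :
  z ^+ f = 1 -> v ^+ l = 1 ->
  \sum_x chr z x * chr v x * (w x)%:~R =
  bisum l f z v (fun i j =>
    \sum_(x : F | [&& x != 0, (dlog x %% l == i)%N & (dlog x %% f == j)%N]) w x).
Proof.
move=> zf vl; rewrite -bisum_partition // [RHS]big_mkcond; apply: eq_bigr => x _.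
rewrite /dlog_char; case: eqVneq => _ /=; [by rewrite !mul0r | ring].
Qed.

Lemma jacobi_partition (B : comNzRingType) (z v : B) (w : F -> int) :
  z ^+ f = 1 -> v ^+ l = 1 ->
  \sum_x chr z x * chr v (1 - x) * (w x)%:~R =
  bisum l f z v (fun i j =>
    \sum_(x : F | [&& (x != 0) && (x != 1), (dlog (1 - x)%R %% l == i)%N
                    & (dlog x %% f == j)%N]) w x).
Proof.
move=> zf vl; rewrite -bisum_partition // [RHS]big_mkcond; apply: eq_bigr => x _.
rewrite /dlog_char subr_eq0 [1 == x]eq_sym.
case: eqVneq => _; first by rewrite !mul0r.
by case: eqVneq => _ /=; [rewrite mulr0 mul0r | ring].
Qed.

Lemma jacobi_jcount (B : comNzRingType) (z v : B) :
  z ^+ f = 1 -> v ^+ l = 1 ->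
  \sum_x chr z x * chr v (1 - x) + 1 = bisum l f z v jcount.
Proof.
move=> zf vl; rewrite /jcount bisumD; congr (_ + _).
  rewrite -jacobi_partition //; apply: eq_bigr => x _.
  by rewrite mulr1.
by rewrite bisum_delta // !expr0 mulr1.
Qed.

(** Summing over [i] counts the [x] in class [j] modulo [f]; the correction at [(0, 0)] restores the
    excluded [x = 1], which makes the column sums equal. *)
Lemma sum_jcount j : (j < f)%N -> \sum_(i < l) jcount i j = (#|F|.-1 %/ f)%N%:Z.
Proof.
move=> hj; rewrite -(card_dlog_class g_prim dvd_f hj) -[RHS]natz -sum1_card natr_sum.
have -> : \sum_(i < l) jcount i j =
    \sum_(x : F | (x != 0) && (x != 1) && (dlog x %% f == j)%N) 1 + ((j == 0)%N : nat)%:Z.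
  rewrite big_split /=; congr (_ + _).
    rewrite [RHS](partition_big (fun x => Ordinal (ltn_pmod (dlog (1 - x)) l_gt0)) xpredT) //=.
    apply: eq_bigr => i _; apply: eq_bigl => x; rewrite -val_eqE /= -!andbA.
    by congr [&& _, _ & _]; rewrite andbC.
  rewrite (bigD1 (Ordinal l_gt0)) //= big1 ?addr0 // => i.
  by rewrite -val_eqE /= => /negbTE ->.
rewrite [RHS](bigID (pred1 1)) /= [RHS]addrC; congr (_ + _); last first.
  have [->|j0] := eqVneq j 0%N.
    rewrite (big_pred1 (1 : F)) // => x /=; rewrite inE.
    by case: (eqVneq x 1) => [->|_]; rewrite ?andbF // oner_eq0 (dlog1 g_prim) mod0n eqxx.
  rewrite big_pred0 // => x /=; rewrite inE; case: (eqVneq x 1) => [->|_]; rewrite ?andbF //.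
  by rewrite (dlog1 g_prim) mod0n [(0 == j)%N]eq_sym (negbTE j0) andbF.
by apply: eq_bigl => x; rewrite inE andbAC.
Qed.

Lemma sum_dlog_char (B : comNzRingType) (z : B) : z ^+ f = 1 ->
  \sum_(j < f) z ^+ j = 0 -> \sum_x chr z x = 0.
Proof.
move=> zf z0; transitivity (\sum_x chr z x * chr 1 x * 1%:~R).
  apply: eq_bigr => x _; rewrite mulr1 /dlog_char; case: eqP => _; first by rewrite mul0r.
  by rewrite expr1n mulr1.
rewrite dlog_char_mul_partition ?expr1n //.
rewrite (eq_bisum _ _ (fun i j hi hj => card_dlog_class2 hi hj)).
exact: bisum_rows.
Qed.

Lemma sum_dlog_char_mul (B : comNzRingType) (z v : B) : z ^+ f = 1 -> v ^+ l = 1 ->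
  \sum_(j < f) z ^+ j = 0 -> \sum_x chr z x * chr v x = 0.
Proof.
move=> zf vl z0; transitivity (\sum_x chr z x * chr v x * 1%:~R).
  by apply: eq_bigr => x _; rewrite mulr1.
rewrite dlog_char_mul_partition //.
rewrite (eq_bisum _ _ (fun i j hi hj => card_dlog_class2 hi hj)).
exact: bisum_rows.
Qed.

(** * Jacobi sums in characteristic [l] *)

Section Modular.
Hypothesis l2_dvd : (l %| #|F|.-1 %/ (l * f))%N.
Variables (B : comNzRingType) (z v : B).
Hypotheses (l0 : l%:R = 0 :> B) (zf : z ^+ f = 1) (vl : v ^+ l = 1).
Hypothesis z_sum : \sum_(j < f) z ^+ j = 0.

Lemma natr_dvd_eq0 n : (l %| n)%N -> n%:R = 0 :> B.
Proof. by case/dvdnP => k ->; rewrite natrM l0 mulr0. Qed.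

Lemma intr_dvd_eq0 (n : int) : (l %| n)%Z -> n%:~R = 0 :> B.
Proof. by case/dvdzP => k ->; rewrite intrM -pmulrn l0 mulr0. Qed.

Lemma natr_mod n : (n %% l)%N%:R = n%:R :> B.
Proof. by rewrite [in RHS](divn_eq n l) natrD natrM l0 mulr0 add0r. Qed.

(** The converse of the last property in [modular_bisum_ring]: column 0 can be subtracted from every
    column at no cost, by [bisum_rows]. *)
Lemma bisum_dvd_eq0 c :
  (forall i j, (i < l)%N -> (j < f)%N -> (l %| c i j - c i 0%N)%Z) ->
  bisum l f z v c = 0.
Proof.
move=> hc; rewrite -[LHS]subr0 -[X in _ - X](@bisum_rows B l f z v (fun i => c i 0%N)) //.
rewrite -bisumB.
rewrite /bisum; apply: big1 => i _; apply: big1 => j _.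
by rewrite intr_dvd_eq0 ?mul0r // hc.
Qed.

(** [1 + v + ... + v^(l-1)] need not vanish here; the sum is zero because [l] divides the size of
    every class. *)
Lemma sum_dlog_char_l : \sum_x chr v x = 0.
Proof.
transitivity (\sum_x chr 1 x * chr v x * 1%:~R).
  apply: eq_bigr => x _; rewrite mulr1 /dlog_char; case: eqP => _; first by rewrite mulr0.
  by rewrite expr1n mul1r.
rewrite dlog_char_mul_partition ?expr1n // /bisum; apply: big1 => i _; apply: big1 => j _.
by rewrite card_dlog_class2 // -pmulrn natr_dvd_eq0 // !mul0r.
Qed.

Lemma sum_dlog_char_dlog : \sum_x chr v x * (dlog x)%:R = 0.
Proof.
transitivity (\sum_x chr 1 x * chr v x * ((dlog x %% l)%N%:Z)%:~R).
  apply: eq_bigr => x _; rewrite -pmulrn natr_mod.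
  by rewrite /dlog_char; case: eqP => _; rewrite ?expr1n ?mul1r ?mulr0.
rewrite dlog_char_mul_partition ?expr1n // /bisum; apply: big1 => i _; apply: big1 => j _.
rewrite (eq_bigr (fun=> i%:Z * 1)) => [|x /and3P[_ /eqP -> _]]; last by rewrite mulr1.
rewrite -mulr_sumr card_dlog_class2 // intr_dvd_eq0 ?mul0r //.
by rewrite dvdz_mull.
Qed.

(** This is [jacobi_cocycle] for [c = dlog]. Modulo [l] the logarithm of [(1 - x)(1 - y)] splits,
    except at [y = 1] where [dlog 0 = 0]; the sum of [b] away from 1 is [-1], whence the minus
    sign. *)
Lemma jacobi_cocycle_dlog (a := chr z) (b := chr v) :
  (\sum_x a x * b (1 - x)) * (\sum_x a x * b x * (dlog (1 - x))%:R) =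
  (\sum_x a x * b (1 - x)) * (\sum_x b x * (dlog (1 - x))%:R)
  - \sum_x a x * b (1 - x) * (dlog (1 - x))%:R.
Proof.
have aM := @dlog_charM F g g_prim B z f _ _ dvd_f zf.
have bM := @dlog_charM F g g_prim B v l _ _ dvd_l vl.
have := @jacobi_cocycle F B a b (fun x => (dlog x)%:R)
  (dlog_char0 g z) (dlog_char1 g_prim z) (dlog_char0 g v) aM bM.
rewrite (dlog1 g_prim) mulr0 mul0r addr0 => ->.
rewrite sum_dlog_char_dlog mulr0 addr0 mulr_suml -sumrB; apply: eq_bigr => x _.
have [->|x1] := eqVneq x 1.
  by rewrite subrr /b dlog_char0 mulr0 !mul0r subrr big1 // => y _; rewrite !mul0r.
under eq_bigr do rewrite -mulrA.
rewrite -mulr_sumr -mulrBr; congr (_ * _).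
transitivity (\sum_y b y * (dlog (1 - y))%:R + (\sum_(y | y != 1) b y) * (dlog (1 - x))%:R).
  rewrite (bigD1 1) //= subrr mulr0 (dlog0 g_prim) mulr0 add0r.
  rewrite [X in _ = X + _](bigD1 1) //= subrr (dlog0 g_prim) mulr0 add0r.
  rewrite mulr_suml -big_split /=; apply: eq_bigr => y y1.
  have := dlogM g_prim (x := 1 - x) (y := 1 - y).
  rewrite !subr_eq0 ![1 == _]eq_sym => /(_ x1 y1) /(modn_dvd_eq dvd_l) e.
  by rewrite -natr_mod e natr_mod natrD; ring.
have := sum_dlog_char_l; rewrite (bigD1 1) //= (dlog_char1 g_prim) => /eqP.
by rewrite addrC addr_eq0 => /eqP ->; ring.
Qed.
(** The weight [dlog (1 - x)] is the exponent of [v], so this is [v d/dv] applied to the Jacobi sum.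
    The correction in [jcount] sits at [i = 0] and drops out. *)
Lemma dlog_moment :
  \sum_x chr z x * chr v (1 - x) * (dlog (1 - x))%:R =
  bisum l f z v (fun i j => i%:Z * jcount i j).
Proof.
transitivity (\sum_x chr z x * chr v (1 - x) * ((dlog (1 - x)%R %% l)%N%:Z)%:~R).
  by apply: eq_bigr => x _; rewrite -pmulrn natr_mod.
rewrite jacobi_partition //; apply: eq_bisum => i j _ _.
rewrite /jcount mulrDr mulr_sumr [X in _ = _ + X](_ : _ = 0).
  by rewrite addr0; apply: eq_bigr => x /and3P[_ /eqP -> _]; rewrite mulr1.
by case: i => [|i]; rewrite ?mul0r ?mulr0.
Qed.

(* As the second sum of [logsum_diff] has trivial first character, all its
   weight sits at [j = 0]. *)
Definition logsum0 i j := logsum i j - (if j == 0%N then \sum_(k < f) logsum i k else 0).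

Lemma logsum_diff :
  \sum_x chr z x * chr v x * (dlog (1 - x))%:R
  - \sum_x chr v x * (dlog (1 - x))%:R = bisum l f z v logsum0.
Proof.
rewrite bisumB -[X in _ = X - _]dlog_char_mul_partition //; congr (_ - _).
transitivity (\sum_x chr 1 x * chr v x * ((dlog (1 - x))%:Z)%:~R).
  by apply: eq_bigr => x _; rewrite /dlog_char expr1n; case: eqP; rewrite ?mul0r ?mul1r.
rewrite dlog_char_mul_partition ?expr1n //; apply: eq_bigr => i _.
rewrite [RHS](bigD1 (Ordinal f_gt0)) //= [X in _ = _ + X]big1 => [|j]; last first.
  by rewrite -val_eqE /=; case: (nat_of_ord j) => // k _; rewrite !mul0r.
rewrite addr0 mulr1 raddf_sum mulr_suml; apply: eq_bigr => j _.
by rewrite expr1n mulr1.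
Qed.
End Modular.

(** Let [T] be the sum of [logsum i k] over [k > 0]; then [logsum0 i 0 = - T]. If every [logsum i k]
    with [k > 0] is [- T] modulo [l], adding them up gives [f T = 0], hence [T = 0], modulo [l]. *)
Lemma logsum0_dvd i : (forall j, (j < f)%N -> (l %| logsum0 i j - logsum0 i 0%N)%Z) <->
  (forall j, (0 < j < f)%N -> (l %| logsum i j)%Z).
Proof.
pose T := \sum_(k < f | k != Ordinal f_gt0) logsum i k.
have sumE : \sum_(k < f) logsum i k = logsum i 0%N + T by rewrite (bigD1 (Ordinal f_gt0)).
have E0 : logsum0 i 0%N = - T by rewrite /logsum0 eqxx sumE; ring.
have Ej j : (0 < j)%N -> logsum0 i j = logsum i j by case: j => // j _; rewrite /logsum0 subr0.
split=> [hj j /andP[j0 jf]|hj [|j] jf]; last first.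
- rewrite E0 Ej // opprK rpredD ?hj //; apply: rpred_sum => k.
  by rewrite -val_eqE /= => k0; apply: hj; rewrite lt0n k0 ltn_ord.
- by rewrite subrr.
have hT k : (0 < k < f)%N -> (l %| logsum i k + T)%Z.
  by case/andP=> k0 /hj; rewrite E0 Ej // opprK.
suff lT : (l %| T)%Z by rewrite -(rpredDr _ lT) hT // j0.
have : (l %| f%:Z * T)%Z.
  have -> : f%:Z * T = \sum_(k < f | k != Ordinal f_gt0) (logsum i k + T).
    rewrite big_split /= sumr_const -/T -mulr_natl.
    have -> : #|[pred k : 'I_f | k != Ordinal f_gt0]| = f.-1 by rewrite cardC1 card_ord.
    by rewrite -[in LHS](prednK f_gt0) natz intS mulrDl mul1r.
  apply: rpred_sum => k; rewrite -val_eqE /= => k0; apply: hT.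
  by rewrite lt0n k0 ltn_ord.
by rewrite Gauss_dvdzr // /coprimez /gcdz /= (eqP coprime_lf).
Qed.

(** Let [J] be the Jacobi sum in [B], [D] its derivative from [dlog_moment], and [S - T] the
    difference in [logsum_diff]. The cocycle identity reads [J S = J T - D]. If [J = -1], then
    [D = 0] and so [S = T]; conversely [S = T] gives [D = 0]. *)
Lemma jcount_logsum : (l %| #|F|.-1 %/ (l * f))%N ->
  (forall i j, (i < l)%N -> (j < f)%N -> (l %| jcount i j - jcount i 0%N)%Z) <->
  (forall i j, (i < l)%N -> (0 < j < f)%N -> (l %| logsum i j)%Z).
Proof.
move=> l2; have [B [z [v [l0 z_sum zf vl lin]]]] := modular_bisum_ring l_prime f_prime.
have /= cocycle := jacobi_cocycle_dlog l2 l0 zf vl.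
rewrite dlog_moment // in cocycle.
have diff := logsum_diff zf vl.
split=> [hN i j hi|hC].
  have J0 := jacobi_jcount zf vl; rewrite bisum_dvd_eq0 // in J0.
  move/eqP: J0; rewrite addr_eq0 => /eqP J0; rewrite J0 !mulN1r in cocycle.
  rewrite (bisum_dvd_eq0 v l0 z_sum) ?subr0 in cocycle; last first.
    by move=> i' j' hi' hj'; rewrite -mulrBr dvdz_mull // hN.
  move/oppr_inj: cocycle diff => ->; rewrite subrr => /esym/lin diff.
  by move: j; apply/logsum0_dvd => j jf; apply: diff.
have lE : bisum l f z v (fun i j => i%:Z * jcount i j) = 0.
  rewrite (bisum_dvd_eq0 v l0 z_sum) in diff; last first.
    by move=> i j hi; move: j; apply/logsum0_dvd => j; apply: hC.
  move/eqP: diff cocycle; rewrite subr_eq0 => /eqP -> /eqP.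
  by rewrite eq_sym subr_eq -subr_eq0 opprD addNKr oppr_eq0 => /eqP.
(* The derivation puts a factor [i] on row [i]. It cancels modulo [l] except for [i = 0]; that row
   follows from the others by equality of the column sums. *)
have pos i j : (0 < i < l)%N -> (j < f)%N -> (l %| jcount i j - jcount i 0%N)%Z.
  case/andP=> i0 hi hj; have := lin _ lE i j hi hj.
  rewrite -mulrBr Gauss_dvdzr // /coprimez /gcdz /=.
  by rewrite -[_ == _]/(coprime l i) prime_coprime // gtnNdvd.
move=> [|i] j hi hj; last exact: pos.
have := sum_jcount hj; rewrite -(sum_jcount f_gt0).
rewrite (bigD1 (Ordinal l_gt0)) //= [in RHS](bigD1 (Ordinal l_gt0)) //= => e.
have -> : jcount 0%N j - jcount 0%N 0%N =
    - \sum_(i < l | i != Ordinal l_gt0) (jcount i j - jcount i 0%N).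
  rewrite sumrB; apply/eqP; rewrite subr_eq opprB addrAC -subr_eq opprK.
  by apply/eqP; rewrite e addrC.
rewrite rpredN; apply: rpred_sum => i; rewrite -val_eqE /= => i0.
by apply: pos => //; rewrite lt0n i0 ltn_ord.
Qed.
End JacobiCounts.

(** * Integers of the cyclotomic field *)

Section ZadjoinClosure.
Variables (K : fieldType) (w : K).

Lemma Zadjoin_int (n : int) : Zadjoin w n%:~R.
Proof. by exists n%:P; rewrite map_polyC hornerC. Qed.

Lemma Zadjoin_gen : Zadjoin w w.
Proof. by exists 'X; rewrite map_polyX hornerX. Qed.

Lemma ZadjoinD x y : Zadjoin w x -> Zadjoin w y -> Zadjoin w (x + y).
Proof. by move=> [p ->] [q ->]; exists (p + q); rewrite rmorphD hornerD. Qed.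

Lemma ZadjoinM x y : Zadjoin w x -> Zadjoin w y -> Zadjoin w (x * y).
Proof. by move=> [p ->] [q ->]; exists (p * q); rewrite rmorphM hornerM. Qed.

Lemma ZadjoinN x : Zadjoin w x -> Zadjoin w (- x).
Proof. by move=> [p ->]; exists (- p); rewrite rmorphN hornerN. Qed.

Lemma Zadjoin1 : Zadjoin w 1. Proof. exact: (Zadjoin_int 1). Qed.

Lemma ZadjoinX x n : Zadjoin w x -> Zadjoin w (x ^+ n).
Proof.
move=> wx; elim: n => [|n IH]; first exact: Zadjoin1.
by rewrite exprS; apply: ZadjoinM.
Qed.

Lemma Zadjoin_sum (I : Type) (r : seq I) (P : pred I) (E : I -> K) :
  (forall i, P i -> Zadjoin w (E i)) -> Zadjoin w (\sum_(i <- r | P i) E i).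
Proof.
move=> wE; apply: (big_ind (Zadjoin w)) => //; first exact: (Zadjoin_int 0).
exact: ZadjoinD.
Qed.
End ZadjoinClosure.

Lemma Zadjoin_trans (K : fieldType) (w x y : K) :
  Zadjoin w x -> Zadjoin x y -> Zadjoin w y.
Proof.
move=> wx [p ->]; rewrite horner_coef; apply: Zadjoin_sum => i _.
apply: ZadjoinM; last exact: ZadjoinX.
by rewrite coef_map; apply: Zadjoin_int.
Qed.

(** * Conjugation of primitive roots of unity *)

Section CyclotomicConjugates.
Variables (L : fieldExtType rat) (n : nat).

Lemma map_intr_in_alg (p : {poly int}) :
  map_poly (intr : int -> L) p = map_poly (in_alg L) (map_poly intr p).
Proof.
rewrite -map_poly_comp; apply: eq_map_poly => k.
by rewrite -[RHS]/(in_alg L k%:~R) rmorph_int.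
Qed.

Lemma intr_fieldExt_inj : injective (intr : int -> L).
Proof.
move=> a b; rewrite -(rmorph_int (in_alg L)) -[b%:~R](rmorph_int (in_alg L)).
by move=> /fmorph_inj /intr_inj.
Qed.

Lemma root_Cyclotomic (w : L) : n.-primitive_root w -> root (map_poly intr 'Phi_n) w.
Proof.
move=> wP; have n0 := prim_order_gt0 wP.
have : root (map_poly intr ('X^n - 1)) w.
  rewrite rmorphB rmorph1 /= map_polyXn rootE !hornerE.
  by rewrite (prim_expr_order wP) subrr.
rewrite -(prod_Cyclotomic n0) rmorph_prod rootE horner_prod prodf_seq_eq0 => /hasP[d].
rewrite -dvdn_divisors // => dn rd; have d0 := dvdn_gt0 n0 dn.
suff -> : n = d by [].
apply/eqP; rewrite eqn_dvd dn andbT (prim_order_dvd wP).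
have : root (map_poly intr ('X^d - 1)) w.
  rewrite -(prod_Cyclotomic d0) rmorph_prod rootE horner_prod prodf_seq_eq0.
  apply/hasP; exists d => //.
  by rewrite -dvdn_divisors.
rewrite rmorphB rmorph1 /= map_polyXn rootE !hornerE subr_eq0.
by move=> /eqP ->.
Qed.

(** Irreducibility of the cyclotomic polynomial [Q] comes from [algC], where [Q] is the minimal
    polynomial of a primitive root. A rational polynomial not divisible by [Q] is coprime to it, so
    it cannot vanish at [w]. *)
Lemma prim_root_conj (w w' : L) (p : {poly int}) :
  n.-primitive_root w -> n.-primitive_root w' ->
  (map_poly intr p).[w] = 0 -> (map_poly intr p).[w'] = 0.
Proof.
move=> wP w'P pw; have n0 := prim_order_gt0 wP.
have [u uP] := C_prim_root_exists n0.
have [Q [QE Qmonic] Qroot] := minCpolyP u.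
have {QE} QE : Q = map_poly intr 'Phi_n.
  apply: (@map_poly_inj _ _ (ratr : rat -> algC)); rewrite -QE (minCpoly_cyclotomic uP).
  rewrite -(Cintr_Cyclotomic uP) -map_poly_comp; apply: eq_map_poly => k.
  by rewrite /= rmorph_int.
have Qw x : n.-primitive_root x -> root (map_poly (in_alg L) Q) x.
  by move/root_Cyclotomic; rewrite map_intr_in_alg QE.
rewrite map_intr_in_alg in pw *; set P := map_poly _ p in pw *.
suff /dvdpP[H ->] : Q %| P by rewrite rmorphM hornerM (eqP (Qw _ w'P)) mulr0.
apply/negPn/negP => nQP; suff : coprimep Q P.
  rewrite -(coprimep_map (in_alg L)) => /coprimep_root /(_ (Qw _ wP)).
  by rewrite pw eqxx.
have /dvdpP[H HE] := dvdp_gcdl Q P.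
have : (Q %| H) || (Q %| gcdp Q P) by rewrite -!Qroot -rootM -rmorphM -HE Qroot.
case/orP => [QH|QG]; last first.
  by case/negP: nQP; apply: dvdp_trans QG (dvdp_gcdr _ _).
have Q0 : Q != 0 := monic_neq0 Qmonic.
rewrite /coprimep; have H0 : H != 0 by apply: contraNneq Q0 => H0; rewrite HE H0 mul0r.
have G0 : gcdp Q P != 0 by apply: contraNneq Q0 => G0; rewrite HE G0 mulr0.
have : (size (H * gcdp Q P)%R <= size H)%N by rewrite -HE dvdp_leq.
rewrite size_mul //.
have : (0 < size (gcdp Q P))%N by rewrite size_poly_gt0.
have : (0 < size H)%N by rewrite size_poly_gt0.
by move: (size H) (size (gcdp Q P)) => a b; clear; lia.
Qed.
End CyclotomicConjugates.

Section CyclotomicIntegers.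
Variables (L : fieldExtType rat) (l f : nat) (w : L).
Hypotheses (l_prime : prime l) (f_prime : prime f) (l_neq_f : l != f).
Hypothesis w_prim : (l * f).-primitive_root w.

Local Notation z := (w ^+ l).
Local Notation v := (w ^+ f).

Let l_gt0 : (0 < l)%N := prime_gt0 l_prime.
Let f_gt0 : (0 < f)%N := prime_gt0 f_prime.

Lemma prim_z : f.-primitive_root z.
Proof.
have := exp_prim_root w_prim l.
by rewrite -[X in gcdn X _]muln1 -muln_gcdr gcd1n muln1 mulKn.
Qed.

Lemma prim_v : l.-primitive_root v.
Proof.
have := exp_prim_root w_prim f; rewrite [(l * f)%N]mulnC.
by rewrite -[X in gcdn X _]muln1 -muln_gcdr gcd1n muln1 mulKn.
Qed.

Lemma prim_root_geom_sum (n : nat) (u : L) : (1 < n)%N -> n.-primitive_root u ->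
  \sum_(i < n) u ^+ i = 0.
Proof.
move=> n1 uP; have : u - 1 != 0.
  by rewrite subr_eq0 -[u]expr1 -(prim_order_dvd uP) dvdn1 gtn_eqF.
by move/mulfI; apply; rewrite mulr0 -subrX1 (prim_expr_order uP) subrr.
Qed.

(* The relation also holds for all conjugates [(z^a, v^b)] of [(z, v)]. *)
Lemma bisum_relation (N : nat -> nat -> int) : bisum l f z v N = 0 ->
  forall i j, (i < l)%N -> (j < f)%N ->
  N i j - N i 0%N = N 0%N j - N 0%N 0%N.
Proof.
move=> N0; have co := coprime_lf l_prime f_prime l_neq_f.
have conj a b : (0 < a < f)%N -> (0 < b < l)%N ->
    \sum_(j < f) (\sum_(i < l) (N i j)%:~R * v ^+ (b * i)) * z ^+ (a * j) = 0.
  (* By the choice of [k], replacing [w] by its conjugate [w^k] turns [z] into [z^a] and [v] into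
     [v^b]. *)
  move=> /andP[a0 af] /andP[b0 bl]; pose k := chinese l f b a.
  have kl : k = b %[mod l] by apply: chinese_modl.
  have kf : k = a %[mod f] by apply: chinese_modr.
  have kP : (l * f).-primitive_root (w ^+ k).
    rewrite prim_root_exp_coprime // coprimeMr.
    rewrite -coprime_modl kl coprime_modl -[coprime k f]coprime_modl kf coprime_modl.
    by rewrite coprime_sym [coprime a f]coprime_sym !prime_coprime // !gtnNdvd.
  pose p : {poly int} := \sum_(i < l) \sum_(j < f) (N i j)%:P * 'X^(l * j + f * i).
  have pE x : (map_poly intr p).[x] = bisum l f (x ^+ l) (x ^+ f) N.
    rewrite rmorph_sum horner_sum; apply: eq_bigr => i _.
    rewrite rmorph_sum horner_sum; apply: eq_bigr => j _ /=.
    by rewrite rmorphM /= map_polyC map_polyXn /= hornerCM hornerXn exprD !exprM mulrA.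
  have := prim_root_conj w_prim kP; move/(_ p); rewrite !pE => /(_ N0) N0k.
  transitivity (bisum l f (w ^+ k ^+ l) (w ^+ k ^+ f) N) => //.
  rewrite /bisum [RHS]exchange_big /=; apply: eq_bigr => j _.
  rewrite mulr_suml; apply: eq_bigr => i _.
  rewrite -![w ^+ k ^+ _]exprAC !exprM -[z ^+ k](prim_expr_mod prim_z).
  rewrite -[v ^+ k](prim_expr_mod prim_v).
  rewrite kl kf (prim_expr_mod prim_z) (prim_expr_mod prim_v).
  by rewrite mulrAC.
move=> i j hi hj; apply: (@intr_fieldExt_inj L); rewrite !intrB.
(* [const_of_prim_roots] is used twice: along [j] for fixed [b], then along [i] for the differences
   of columns. *)
have step b : (0 < b < l)%N ->
    \sum_(i < l) ((N i j)%:~R - (N i 0%N)%:~R) * v ^+ (b * i) = 0.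
  move=> hb; have := const_of_prim_roots (c := fun j => \sum_(i < l) (N i j)%:~R * v ^+ (b * i))
    f_prime prim_z (fun a ha => conj a b ha hb) hj.
  move/eqP; rewrite -subr_eq0 -sumrB => /eqP e; rewrite -[RHS]e.
  by apply: eq_bigr => i' _; rewrite mulrBl.
exact: (const_of_prim_roots (c := fun i => (N i j)%:~R - (N i 0%N)%:~R) l_prime prim_v step hi).
Qed.

(** Each power of [w] is some [z^a v^b], and multiplication by [v - 1] makes it
    [z^a (v^(b+1) - v^b)], whose coefficients cancel within one column. *)
Lemma Zadjoin_bisum y : Zadjoin w y -> exists2 Y,
  (v - 1) * y = bisum l f z v Y & forall j, (j < f)%N -> \sum_(i < l) Y i j = 0.
Proof.
move=> [p ->]; rewrite horner_coef mulr_sumr; set n := size _.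
elim: n => [|n [Y YE Y0]].
  rewrite big_ord0; exists (fun _ _ => 0); last by move=> j _; rewrite big1.
  by rewrite bisum_rows //; apply: prim_root_geom_sum (prime_gt1 f_prime) prim_z.
rewrite big_ord_recr /= YE coef_map /=.
have co := coprime_lf l_prime f_prime l_neq_f.
(* [t] and [u] are the idempotents of the Chinese remainder theorem: [w = w^t w^u] with [l] dividing
   [t] and [f] dividing [u]. *)
have [a [b wE]] : exists a b, w = z ^+ a * v ^+ b.
  pose t := chinese l f 0 1; pose u := chinese l f 1 0.
  have tl : t = 0 %[mod l] by apply: chinese_modl.
  have tf : t = 1 %[mod f] by apply: chinese_modr.
  have ul : u = 1 %[mod l] by apply: chinese_modl.
  have uf : u = 0 %[mod f] by apply: chinese_modr.
  exists (t %/ l)%N, (u %/ f)%N; rewrite -!exprM -exprD ![(_ * (_ %/ _))%N]mulnC.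
  rewrite !divnK /dvdn ?tl ?uf ?mod0n //.
  rewrite -[in LHS](expr1 w); apply/eqP; rewrite (eq_prim_root_expr w_prim).
  have e1 : (t + u)%N = 1 %[mod l] by rewrite -modnDm tl ul modnDm.
  have e2 : (t + u)%N = 1 %[mod f] by rewrite -modnDm tf uf modnDm.
  by rewrite chinese_remainder // e1 e2 !eqxx.
pose d k i j : int := (((i == k %% l) && (j == (a * n) %% f))%N : nat)%:Z.
have dE k : bisum l f z v (d k) = z ^+ (a * n) * v ^+ k.
  rewrite bisum_delta ?ltn_pmod //.
  by rewrite (prim_expr_mod prim_z) (prim_expr_mod prim_v).
exists (fun i j => Y i j + p`_n * (d (b * n).+1 i j - d (b * n)%N i j)).
  rewrite bisumD bisumZ bisumB !dE; congr (_ + _).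
  have -> : w ^+ n = z ^+ (a * n) * v ^+ (b * n) by rewrite {1}wE exprMn !exprM.
  by rewrite exprS; ring.
move=> j jf; rewrite big_split Y0 //= add0r -mulr_sumr sumrB.
have d1 k : \sum_(i < l) d k i j = ((j == (a * n) %% f)%N : nat)%:Z.
  rewrite (bigD1 (Ordinal (ltn_pmod k l_gt0))) //= big1 ?addr0 => [|i].
    by rewrite /d eqxx.
  by rewrite -val_eqE /d /= => /negbTE ->.
by rewrite !d1 subrr mulr0.
Qed.

(** This is [bisum_relation] for [N - t Y], with [Y] representing [(v - 1) y]. The vanishing column
    sums let a later summation over [i] eliminate [Y]. *)
Lemma bisum_mod (N : nat -> nat -> int) (t : int) y :
  Zadjoin w y -> bisum l f z v N = t%:~R * ((v - 1) * y) ->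
  exists2 Y : nat -> nat -> int, (forall j, (j < f)%N -> \sum_(i < l) Y i j = 0) &
  forall i j, (i < l)%N -> (j < f)%N ->
    N i j - N i 0%N - t * (Y i j - Y i 0%N) =
    N 0%N j - N 0%N 0%N - t * (Y 0%N j - Y 0%N 0%N).
Proof.
move=> /Zadjoin_bisum[Y -> Y0] NE; exists Y => // i j hi hj.
have := @bisum_relation (fun i j => N i j - t * Y i j) _ i j hi hj.
rewrite bisumB bisumZ NE subrr => /(_ erefl) e.
by transitivity (N i j - t * Y i j - (N i 0%N - t * Y i 0%N)); [ring | rewrite e; ring].
Qed.

(** Both sides are the value of [(X^l - 1)/(X - 1)] at 1. *)
Lemma prod_1_sub_v : \prod_(1 <= k < l) (1 - v ^+ k) = l%:R.
Proof.
have := factor_Xn_sub_1 prim_v; rewrite subrX1 big_ltn // expr0.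
move/(mulfI (negbT (polyXsubC_eq0 _))) => /(congr1 (fun p => p.[1])).
rewrite horner_prod horner_sum => e.
transitivity (\prod_(1 <= k < l) ('X - (v ^+ k)%:P).[1]).
  by apply: eq_bigr => k _; rewrite !hornerE.
rewrite e (eq_bigr (fun=> 1)) => [|i _]; last by rewrite hornerXn expr1n.
by rewrite sumr_const card_ord.
Qed.

Lemma Zadjoin_v : Zadjoin w v. Proof. exact/ZadjoinX/Zadjoin_gen. Qed.
Lemma Zadjoin_z : Zadjoin w z. Proof. exact/ZadjoinX/Zadjoin_gen. Qed.

Lemma Zadjoin_geom_dvd (u : L) k : Zadjoin w u ->
  exists2 y, Zadjoin w y & 1 - u ^+ k = (1 - u) * y.
Proof.
move=> wu; exists (\sum_(i < k) u ^+ i); first by apply: Zadjoin_sum => i _; apply: ZadjoinX.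
by rewrite -opprB subrX1 -mulNr opprB.
Qed.

Lemma Zadjoin_dvd_prod (I : eqType) (r : seq I) (a b : I -> L) :
  {in r, forall i, exists2 y, Zadjoin w y & a i = b i * y} ->
  exists2 y, Zadjoin w y & \prod_(i <- r) a i = \prod_(i <- r) b i * y.
Proof.
elim: r => [|i r IH] ab.
  by exists 1; [exact: Zadjoin1 | rewrite !big_nil mulr1].
have [j jr|y wy yE] := IH; first by apply: ab; rewrite inE jr orbT.
have [|x wx xE] := ab i; first exact: mem_head.
by exists (x * y); [exact: ZadjoinM | rewrite !big_cons xE yE; ring].
Qed.

Lemma sub1_exp_prime : (v - 1) ^+ l = (-1) ^+ l.-1 * (v - 1) * \prod_(1 <= k < l) (1 - v).
Proof.
rewrite big_const_nat iter_mulr_1 subn1 -[in LHS](prednK l_gt0) exprS.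
have -> : (v - 1) ^+ l.-1 = (-1) ^+ l.-1 * (1 - v) ^+ l.-1.
  by rewrite -exprMn mulN1r opprB.
by ring.
Qed.

(* [v - 1] generates the prime above [l] in [Z[v]], and [l] is associate to
   [(v - 1)^(l-1)]. *)
Lemma sub1_exp_dvd_l :
  exists2 y, Zadjoin w y & (v - 1) ^+ l = l%:R * ((v - 1) * y).
Proof.
have [|y wy yE] := @Zadjoin_dvd_prod _ (index_iota 1 l) (fun=> 1 - v) (fun k => 1 - v ^+ k).
  move=> k; rewrite mem_index_iota => /andP[k0 kl].
  have kP : l.-primitive_root (v ^+ k).
    by rewrite (prim_root_exp_coprime _ prim_v) coprime_sym prime_coprime // gtnNdvd.
  (* [v] is in turn a power of [v^k], so [1 - v^k] divides [1 - v]. *)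
  have [i iE] := prim_rootP kP (prim_expr_order prim_v).
  have [|y wy yE] := @Zadjoin_geom_dvd (v ^+ k) i; first exact/ZadjoinX/Zadjoin_v.
  by exists y; rewrite // -yE -iE.
exists ((-1) ^+ l.-1 * y); last by rewrite sub1_exp_prime yE prod_1_sub_v; ring.
by apply: ZadjoinM => //; apply/ZadjoinX/ZadjoinN/Zadjoin1.
Qed.

(** The other half of the association: [l] is the product of the [1 - v^k], all multiples of
    [1 - v]. *)
Lemma l_dvd_sub1_exp :
  exists2 y, Zadjoin w y & l%:R * (v - 1) = (v - 1) ^+ l * y.
Proof.
have [|y wy yE] := @Zadjoin_dvd_prod _ (index_iota 1 l) (fun k => 1 - v ^+ k) (fun=> 1 - v).
  by move=> k _; apply: Zadjoin_geom_dvd; exact: Zadjoin_v.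
exists ((-1) ^+ l.-1 * y).
  by apply: ZadjoinM => //; apply/ZadjoinX/ZadjoinN/Zadjoin1.
rewrite sub1_exp_prime -prod_1_sub_v yE.
have s1 : (-1) ^+ l.-1 * (-1) ^+ l.-1 = 1 :> L by rewrite -exprMn mulrNN mulr1 expr1n.
set S := \prod_(_ <= _ < _) _; set s := (-1) ^+ l.-1 in s1 *.
by transitivity (s * s * (S * y * (v - 1))); [rewrite s1 mul1r | ring].
Qed.

(** After subtraction of column 0 the coefficients are [l k(i,j)], and the columns of [k] sum to
    zero. So [v0^i] may be replaced by [v0^i - 1], a multiple of [v0 - 1]. General [z0], [v0] allow
    for inverses of [z] and [v]. *)
Lemma bisum_dvd (z0 v0 : L) (N : nat -> nat -> int) :
  Zadjoin w z0 -> Zadjoin w v0 -> \sum_(j < f) z0 ^+ j = 0 ->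
  (forall i j, (i < l)%N -> (j < f)%N -> (l %| N i j - N i 0%N)%Z) ->
  (forall j, (j < f)%N -> \sum_(i < l) N i j = \sum_(i < l) N i 0%N) ->
  exists2 y, Zadjoin w y & bisum l f z0 v0 N = l%:R * ((v0 - 1) * y).
Proof.
move=> wz wv z0s Nl Ns; pose k i j := ((N i j - N i 0%N) %/ l)%Z.
have kE i j : (i < l)%N -> (j < f)%N -> l%:Z * k i j = N i j - N i 0%N.
  by move=> hi hj; rewrite mulrC divzK // Nl.
have k0 j : (j < f)%N -> \sum_(i < l) k i j = 0.
  move=> hj; have lz : l%:Z != 0 by rewrite -lt0n.
  apply: (mulfI lz); rewrite mulr0 mulr_sumr.
  transitivity (\sum_(i < l) (N i j - N i 0%N)); first by apply: eq_bigr => i _; rewrite kE.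
  by rewrite sumrB Ns // subrr.
exists (\sum_(i < l) \sum_(j < f) (k i j)%:~R * z0 ^+ j * \sum_(u < i) v0 ^+ u).
  apply: Zadjoin_sum => i _; apply: Zadjoin_sum => j _.
  apply: ZadjoinM; last by apply: Zadjoin_sum => u _; apply: ZadjoinX.
  by apply: ZadjoinM; [exact: Zadjoin_int | exact: ZadjoinX].
transitivity (l%:R * bisum l f z0 v0 k).
  rewrite -[LHS]subr0 -[X in _ - X](@bisum_rows _ l f z0 v0 (fun i => N i 0%N)) //.
  rewrite -bisumB -[l%:R]/(l%:Z%:~R) -bisumZ.
  by apply: eq_bisum => i j hi hj; rewrite kE.
congr (_ * _); rewrite mulr_sumr; have k1 : bisum l f z0 1 k = 0.
  rewrite /bisum exchange_big big1 //= => j _.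
  under eq_bigr do rewrite expr1n mulr1.
  by rewrite -mulr_suml -raddf_sum /= k0 // mul0r.
rewrite -[LHS]subr0 -[X in _ - X = _]k1 -sumrB; apply: eq_bigr => i _.
rewrite -sumrB mulr_sumr; apply: eq_bigr => j _.
by rewrite expr1n -mulrBr subrX1; ring.
Qed.
End CyclotomicIntegers.

(** Used to pass between [zeta] and [chi g], which may be different primitive roots: as [w] is a
    power of [w'], [w^f - 1] is a multiple of [w'^f - 1]. *)
Lemma Zadjoin_prim_root (L : fieldExtType rat) (n f e : nat) (w w' x : L) :
  n.-primitive_root w -> n.-primitive_root w' ->
  (exists2 y, Zadjoin w y & x = (w ^+ f - 1) ^+ e * y) ->
  exists2 y, Zadjoin w' y & x = (w' ^+ f - 1) ^+ e * y.
Proof.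
move=> wP w'P [y wy ->]; have [k wE] := prim_rootP w'P (prim_expr_order wP).
have w'w : Zadjoin w' w by rewrite wE; exact/ZadjoinX/Zadjoin_gen.
have w'y : Zadjoin w' y by apply: Zadjoin_trans wy.
exists ((\sum_(u < k) (w' ^+ f) ^+ u) ^+ e * y).
  apply: ZadjoinM => //; apply: ZadjoinX; apply: Zadjoin_sum => u _.
  exact/ZadjoinX/ZadjoinX/Zadjoin_gen.
by rewrite mulrA -exprMn -subrX1 wE exprAC.
Qed.

Lemma invr_root_of_unity (K : fieldType) (n : nat) (u : K) :
  (0 < n)%N -> u ^+ n = 1 -> u^-1 = u ^+ n.-1.
Proof.
move=> n0 un; have u0 : u != 0.
  by apply: contra_eq_neq un => ->; rewrite expr0n gtn_eqF // eq_sym oner_neq0.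
by apply: (mulfI u0); rewrite divff // -exprS prednK // un.
Qed.

(** * Divisibility of [J + 1] and its effect on [q] *)

Section JacobiDivisibility.
Variables (F : finFieldType) (g : F) (l f : nat).
Hypothesis g_prim : (#|F|.-1).-primitive_root g.
Hypotheses (l_prime : prime l) (f_prime : prime f) (l_neq_f : l != f).
Hypothesis lf_dvd : (l * f %| #|F|.-1)%N.
Variables (L : fieldExtType rat) (w : L).
Hypothesis w_prim : (l * f).-primitive_root w.

Local Notation z := (w ^+ l).
Local Notation v := (w ^+ f).
Local Notation chr := (dlog_char g).
Local Notation jcount := (jcount g l f).
Local Notation zP := (prim_z l_prime w_prim).
Local Notation vP := (prim_v f_prime w_prim).

Let z_sum : \sum_(j < f) z ^+ j = 0.
Proof. exact: prim_root_geom_sum (prime_gt1 f_prime) zP. Qed.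

Let jcount_sum j : (j < f)%N -> \sum_(i < l) jcount i j = \sum_(i < l) jcount i 0%N.
Proof.
move=> jf; rewrite (sum_jcount g_prim l_prime lf_dvd) //.
by rewrite (sum_jcount g_prim l_prime lf_dvd) // prime_gt0.
Qed.

Let jacobi_bisum (z0 v0 : L) : z0 ^+ f = 1 -> v0 ^+ l = 1 ->
  \sum_x chr z0 x * chr v0 (1 - x) + 1 = bisum l f z0 v0 jcount.
Proof. exact: jacobi_jcount. Qed.

(** From left to right, [bisum_mod] with [t = l] makes the difference of columns [j] and 0 a
    constant [c] modulo multiples of [l]; summing over [i] gives [l c = 0], because the column sums
    agree. *)
Lemma jacobi_dvd_jcount :
  (exists2 y, Zadjoin w y &
     \sum_x chr z x * chr v (1 - x) + 1 = (v - 1) ^+ l * y) <->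
  (forall i j, (i < l)%N -> (j < f)%N -> (l %| jcount i j - jcount i 0%N)%Z).
Proof.
rewrite jacobi_bisum ?(prim_expr_order zP) ?(prim_expr_order vP) //.
split=> [[y wy]|jl]; last first.
  have [y wy ->] := bisum_dvd l_prime (Zadjoin_z l w) (Zadjoin_v f w) z_sum jl jcount_sum.
  have [y' wy' e] := l_dvd_sub1_exp l_prime f_prime w_prim.
  by exists (y' * y); [exact: ZadjoinM | rewrite mulrA e; ring].
have [y' wy' ->] := sub1_exp_dvd_l l_prime f_prime w_prim.
rewrite -!mulrA -[l%:R]/(l%:Z%:~R).
case/(bisum_mod l_prime f_prime l_neq_f w_prim (ZadjoinM wy' wy)) => Y Y0 e i j hi hj.
pose c := jcount 0%N j - jcount 0%N 0%N - l%:Z * (Y 0%N j - Y 0%N 0%N).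
have c0 : c = 0.
  have l0 : l%:Z != 0 by rewrite -lt0n prime_gt0.
  apply: (mulfI l0); rewrite mulr0.
  transitivity (\sum_(i < l) c); first by rewrite sumr_const card_ord -mulr_natl natz.
  transitivity (\sum_(i < l) (jcount i j - jcount i 0%N - l%:Z * (Y i j - Y i 0%N))).
    by apply: eq_bigr => i' _; rewrite e.
  rewrite !sumrB -mulr_sumr sumrB jcount_sum // !Y0 ?prime_gt0 //.
  by rewrite !subrr mulr0.
move: (e i j hi hj); rewrite -/c c0 => /eqP; rewrite subr_eq0 => /eqP ->.
exact: dvdz_mulr.
Qed.

Lemma dlog_charV (n : nat) (u : L) x : (n %| #|F|.-1)%N -> u ^+ n = 1 ->
  chr u x^-1 = chr u^-1 x.
Proof.
move=> nq un; have [->|x0] := eqVneq x 0; first by rewrite invr0 !dlog_char0.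
have := dlog_charM g_prim x x^-1 nq un; rewrite divff // dlog_char1 // => /esym e.
have -> : chr u^-1 x = (chr u x)^-1 by rewrite /dlog_char (negbTE x0) exprVn.
have ux : chr u x != 0.
  by apply/eqP => u0; move/eqP: e; rewrite u0 mul0r eq_sym oner_eq0.
by apply: (mulfI ux); rewrite e divff.
Qed.

(** [J] and its conjugate are both [-1] up to multiples of [l (v - 1)], and their product is [q].
    Hence [v - 1] divides [(q - 1)/l = M f], and a rational integer divisible by [v - 1] is
    divisible by [l]. *)
Lemma jcount_dvd_card :
  (forall i j, (i < l)%N -> (j < f)%N -> (l %| jcount i j - jcount i 0%N)%Z) ->
  (l %| #|F|.-1 %/ (l * f))%N.
Proof.
move=> jl; have f1 := prime_gt1 f_prime; have l1 := prime_gt1 l_prime.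
have f0 := prime_gt0 f_prime; have l0 := prime_gt0 l_prime.
have zf := prim_expr_order zP; have vl := prim_expr_order vP.
have lq := dvd_l lf_dvd; have fq := dvd_f lf_dvd.
have v1 : v != 1 by rewrite -[v]expr1 -(prim_order_dvd vP) dvdn1 gtn_eqF.
have z1 : z != 1 by rewrite -[z]expr1 -(prim_order_dvd zP) dvdn1 gtn_eqF.
have zV : z^-1 = z ^+ f.-1 by exact: invr_root_of_unity.
have vV : v^-1 = v ^+ l.-1 by exact: invr_root_of_unity.
have wzV : Zadjoin w z^-1 by rewrite zV; apply: ZadjoinX; exact: Zadjoin_z.
have wvV : Zadjoin w v^-1 by rewrite vV; apply: ZadjoinX; exact: Zadjoin_v.
have zfV : z^-1 ^+ f = 1 by rewrite exprVn zf invr1.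
have vlV : v^-1 ^+ l = 1 by rewrite exprVn vl invr1.
have zV_sum : \sum_(j < f) z^-1 ^+ j = 0.
  have : z^-1 - 1 != 0 by rewrite subr_eq0 invr_eq1.
  by move/mulfI; apply; rewrite mulr0 -subrX1 zfV subrr.
have v_sum : \sum_(i < l) v ^+ i = 0 by exact: prim_root_geom_sum l1 vP.
have [y wy Jy] := bisum_dvd l_prime (Zadjoin_z l w) (Zadjoin_v f w) z_sum jl jcount_sum.
have [y' wy' Jy'] := bisum_dvd l_prime wzV wvV zV_sum jl jcount_sum.
rewrite -jacobi_bisum // in Jy; rewrite -jacobi_bisum // in Jy'.
have norm := jacobi_norm (dlog_char0 g z) (dlog_char1 g_prim z)
  (dlog_char0 g v) (dlog_char1 g_prim v)
  (fun x y => dlog_charM g_prim x y fq zf) (fun x y => dlog_charM g_prim x y lq vl).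
rewrite (sum_dlog_char g_prim l_prime f_prime l_neq_f lf_dvd zf z_sum) in norm.
rewrite (sum_dlog_char g_prim f_prime l_prime _ _ vl v_sum) in norm;
  rewrite ?[(f * l)%N]mulnC // 1?eq_sym //.
rewrite (sum_dlog_char_mul g_prim l_prime f_prime l_neq_f lf_dvd zf vl z_sum) in norm.
move: norm => /(_ erefl erefl erefl).
under [X in _ * X]eq_bigr do rewrite (dlog_charV _ fq zf) (dlog_charV _ lq vl).
set J := \sum_x _ in Jy *; set J' := \sum_x _ in Jy' * => norm.
set M := (#|F|.-1 %/ (l * f))%N.
have qE : #|F|%:R - 1 = l%:R * (M * f)%:R :> L.
  have F0 : (0 < #|F|)%N by apply/card_gt0P; exists 0.
  have -> : l%:R * (M * f)%:R = #|F|.-1%:R :> L by rewrite -natrM mulnCA divnK.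
  by rewrite -[in LHS](prednK F0) -natr1 addrK.
(* [Y] is [(J J' - 1)/(l (v - 1))] expanded, using [v^-1 - 1 = - v^-1 (v - 1)]. *)
pose Y := l%:R * (v^-1 - 1) * y * y' - y + v^-1 * y'.
have wY : Zadjoin w Y.
  apply: ZadjoinD; last exact: ZadjoinM.
  apply: ZadjoinD; last exact: ZadjoinN.
  apply: ZadjoinM => //; apply: ZadjoinM => //; apply: ZadjoinM.
    exact: (Zadjoin_int w l).
  by apply: ZadjoinD => //; apply/ZadjoinN/Zadjoin1.
have lL : l%:R != 0 :> L.
  by apply/eqP => /(@intr_fieldExt_inj L l 0) [] e; move: l0; rewrite e.
have v0 : v != 0 by apply: contra_eq_neq vl => ->; rewrite expr0n gtn_eqF // eq_sym oner_neq0.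
have ME : (M * f)%:R = (v - 1) * Y.
  apply: (mulfI lL); rewrite -qE -norm.
  have -> : J = l%:R * ((v - 1) * y) - 1 by rewrite -Jy addrK.
  have -> : J' = l%:R * ((v^-1 - 1) * y') - 1 by rewrite -Jy' addrK.
  by rewrite /Y; field.
(* The integer [M f] is placed at [(0, 0)]; comparing the sums of columns 1 and 0 then gives
   [l c = - M f]. *)
pose N i j : int := (M * f)%N%:Z * (((i == 0) && (j == 0))%N : nat)%:Z.
have NE : bisum l f z v N = 1%:~R * ((v - 1) * Y).
  by rewrite bisumZ bisum_delta // !expr0 mulr1 mulr1 mul1r -ME.
have [Z Z0 e] := bisum_mod l_prime f_prime l_neq_f w_prim wY NE.
pose c := N 0%N 1%N - N 0%N 0%N - 1 * (Z 0%N 1%N - Z 0%N 0%N).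
have sN j : (j < f)%N -> \sum_(i < l) N i j = (M * f)%N%:Z * ((j == 0)%N : nat)%:Z.
  move=> jf; rewrite (bigD1 (Ordinal l0)) //= big1 ?addr0 // => i.
  by rewrite -val_eqE /N /= => /negbTE ->; rewrite mulr0.
have : \sum_(i < l) c = - (M * f)%N%:Z.
  transitivity (\sum_(i < l) (N i 1%N - N i 0%N - (Z i 1%N - Z i 0%N))).
    by apply: eq_bigr => i _; rewrite /c -(e i) // mul1r.
  by rewrite !sumrB !sN // !Z0 // !(mulr0, subrr, subr0, mulr1, sub0r).
rewrite sumr_const card_ord -mulr_natl natz => cE.
have : (l %| M * f)%N.
  by have := dvdz_mulr c (dvdzz l); rewrite cE dvdzE abszN.
by rewrite Gauss_dvdl // coprime_lf.
Qed.
End JacobiDivisibility.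

(** * Power residues *)

Section PowerResidues.
Variables (F : finFieldType) (g : F) (l f : nat).
Hypothesis g_prim : (#|F|.-1).-primitive_root g.
Hypotheses (l_prime : prime l) (f_prime : prime f) (l_neq_f : l != f).
Hypothesis lf_dvd : (l * f %| #|F|.-1)%N.

Local Notation dlog := (dlog g).
Local Notation M := (#|F|.-1 %/ (l * f))%N.

Lemma dlog_prod (I : Type) (r : seq I) (P : pred I) (E : I -> F) :
  (forall x, P x -> E x != 0) ->
  dlog (\prod_(x <- r | P x) E x) = (\sum_(x <- r | P x) dlog (E x))%N %[mod #|F|.-1].
Proof.
move=> E0; suff [] : \prod_(x <- r | P x) E x != 0 /\
  dlog (\prod_(x <- r | P x) E x) = (\sum_(x <- r | P x) dlog (E x))%N %[mod #|F|.-1] by [].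
apply: (big_ind2 (fun a b => a != 0 /\ dlog a = b %[mod #|F|.-1])).
- by rewrite oner_neq0 (dlog1 g_prim).
- move=> a b a' b' [a0 ab] [a'0 a'b']; split; first by rewrite mulf_neq0.
  by rewrite (dlogM g_prim) // -modnDm ab a'b' modnDm.
by move=> x Px; split; first exact: E0.
Qed.

(** The class has [M] elements, which are all the roots of [X^M - g^(M s)]; the factorization is
    evaluated at 1. *)
Lemma prod_1_sub_class s :
  \prod_(x | (x != 0) && (dlog x == s %[mod l * f])) (1 - x) = 1 - g ^+ (M * s).
Proof.
have lf0 : (0 < l * f)%N by rewrite muln_gt0 !prime_gt0.
have q0 := prim_order_gt0 g_prim.
have M0 : (0 < M)%N by rewrite divn_gt0 // dvdn_leq.
pose A := [pred x : F | (x != 0) && (dlog x == s %[mod l * f])].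
pose p : {poly F} := 'X^M - (g ^+ (M * s))%:P.
have sp : size p = M.+1 by apply: size_XnsubC.
have pE : p = \prod_(x <- enum A) ('X - x%:P).
  rewrite [LHS](@all_roots_prod_XsubC _ p (enum A)) ?sp.
  - have -> : lead_coef p = 1 by apply/eqP; rewrite -monicE monicXnsubC.
    by rewrite scale1r.
  - by rewrite -cardE (card_dlog_class g_prim lf_dvd) // ltn_pmod.
  - apply/allP => x; rewrite mem_enum inE => /andP[x0 xs].
    rewrite rootE !hornerE subr_eq0 -{1}(dlogK g_prim x0) -exprM.
    rewrite (eq_prim_root_expr g_prim) [(dlog x * M)%N]mulnC.
    rewrite -[X in (_ == _ %[mod X])%N](divnK lf_dvd) -!muln_modr.
    by rewrite (eqP xs).
  - by rewrite uniq_rootsE enum_uniq.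
have := congr1 (fun p => p.[1]) pE.
rewrite /p !hornerE expr1n horner_prod => ->; rewrite big_enum /=.
by apply: eq_bigr => x _; rewrite !hornerE.
Qed.

(** As [j > 0], the class does not contain 1, so no factor [1 - x] vanishes and logarithms add
    up. *)
Lemma logsum_dlog i j s : (j < f)%N -> (0 < j)%N -> (i < l)%N ->
  s = i %[mod l] -> s = j %[mod f] ->
  (1 - g ^+ (M * s) != 0) /\
  (l %| logsum g l f i j)%Z = (l %| dlog (1 - g ^+ (M * s))%R)%N.
Proof.
move=> jf j0 il si sj; have co := coprime_lf l_prime f_prime l_neq_f.
rewrite -prod_1_sub_class.
have nz x : (x != 0) && (dlog x == s %[mod l * f]) -> 1 - x != 0.
  case/andP=> x0 xs; rewrite subr_eq0; apply/negP => /eqP x1.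
  move: xs; rewrite -x1 (dlog1 g_prim) chinese_remainder // sj !mod0n (modn_small jf).
  by case/andP=> _ /eqP e; rewrite -e in j0.
split; first by apply/prodf_neq0 => x /nz.
have := modn_dvd_eq (dvd_l lf_dvd) (@dlog_prod _ (index_enum F) _ _ nz).
rewrite /dvdn => ->; rewrite -[RHS]/(l %| _)%N.
have -> : logsum g l f i j =
  (\sum_(x : F | (x != 0%R) && (dlog x == s %[mod l * f])) dlog (1 - x)%R)%N%:Z.
  rewrite -natz natr_sum; apply: eq_big => [x|x _]; last by rewrite natz.
  by rewrite chinese_remainder // si sj !(modn_small il, modn_small jf).
by [].
Qed.

Lemma dlog_eq_dvd x y : x != 0 -> y != 0 -> (l %| dlog y)%N ->
  (l %| dlog (x * y)%R)%N = (l %| dlog x)%N.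
Proof.
move=> x0 y0 ly; have := modn_dvd_eq (dvd_l lf_dvd) (dlogM g_prim x0 y0).
by rewrite /dvdn => ->; rewrite -[LHS]/(l %| _)%N dvdn_addl.
Qed.

(** [l^2] divides [q - 1], which divides [2 dlog(-1)]; the second factor [l] serves for [l = 2]. *)
Lemma dvd_dlog_N1 : (l %| M)%N -> (l %| dlog (-1)%R)%N.
Proof.
move=> lM; have n1 : -1 != 0 :> F by rewrite oppr_eq0 oner_neq0.
have ll : (l * l %| #|F|.-1)%N.
  by rewrite -(divnK lf_dvd) mulnA dvdn_mulr // dvdn_mul.
have : (#|F|.-1 %| dlog (-1)%R + dlog (-1)%R)%N.
  by rewrite /dvdn -(dlogM g_prim n1 n1) mulrNN mulr1 (dlog1 g_prim) mod0n.
move/(dvdn_trans ll); rewrite addnn -mul2n.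
have [->|l2] := eqVneq l 2; first by rewrite dvdn_pmul2l.
move/(dvdn_trans (dvdn_mulr _ (dvdnn _))); rewrite Gauss_dvdr //.
by rewrite prime_coprime // dvdn_prime2.
Qed.

(** With [u = g^(M s)] one has [g^(M t) = u^-1] and [1 - u = - u (1 - u^-1)], where [- u] is an
    [l]-th power since [l] divides [M]. *)
Lemma dvd_dlog_inv s t : (l %| M)%N -> (l * f %| s + t)%N -> 1 - g ^+ (M * s) != 0 ->
  (l %| dlog (1 - g ^+ (M * s))%R)%N = (l %| dlog (1 - g ^+ (M * t))%R)%N.
Proof.
move=> lM st ns; have g0 := prim_neq0 g_prim.
have gst : g ^+ (M * s) * g ^+ (M * t) = 1.
  rewrite -exprD -mulnDr; apply/eqP; rewrite -(prim_order_dvd g_prim).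
  by rewrite -[X in (X %| _)%N](divnK lf_dvd) dvdn_mul.
have nt : 1 - g ^+ (M * t) != 0.
  by apply: contra ns; rewrite !subr_eq0 => /eqP e; rewrite -gst -e mulr1.
have dg : (l %| dlog (-1 * g ^+ (M * s))%R)%N.
  rewrite dlog_eq_dvd ?expf_neq0 ?oppr_eq0 ?oner_neq0 //; first exact: dvd_dlog_N1.
  have := modn_dvd_eq (dvd_l lf_dvd) (dlog_exp g_prim (M * s)).
  by rewrite /dvdn => ->; apply: dvdn_mulr.
rewrite -[RHS](dlog_eq_dvd nt _ dg) ?mulf_neq0 ?expf_neq0 ?oppr_eq0 ?oner_neq0 //.
congr (_ %| dlog _)%N; transitivity (g ^+ (M * s) * g ^+ (M * t) - g ^+ (M * s)); last by ring.
by rewrite gst.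
Qed.
End PowerResidues.

(** * From units and characters to discrete logarithms *)

Lemma expr_coprime_eq1 (R : nzRingType) (m n : nat) (t : R) :
  coprime m n -> t ^+ m = 1 -> t ^+ n = 1 -> t = 1.
Proof.
move=> co tm tn; have := expr_mod (chinese m n 0 1) tn.
rewrite chinese_modr // (expr_mod _ tn) expr1 => ->.
by rewrite -(expr_mod _ tm) chinese_modl // mod0n.
Qed.

Lemma mem_unit_powers (F : finFieldType) (g : {unit F}) (l : nat) (x : F) :
  (#|F|.-1).-primitive_root (val g) -> (l %| #|F|.-1)%N -> x != 0 ->
  (x \in unit_powers F l) = (l %| dlog (val g) x)%N.
Proof.
move=> gP lq x0; apply/imsetP/idP => [[u _ xE]|/dvdnP[k kE]].
  have u0 : val u != 0 by rewrite -unitfE (valP u).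
  rewrite xE FinRing.val_unitX -(dlogK gP u0) -exprM /dvdn.
  by rewrite (modn_dvd_eq lq (dlog_exp gP _)) modnMl.
exists (g ^+ k)%g => //; rewrite !FinRing.val_unitX -exprM -kE dlogK //.
Qed.

Lemma prim_root_generator (F : finFieldType) (g : {unit F}) :
  generator [set: {unit F}] g -> (#|F|.-1).-primitive_root (val g).
Proof.
move=> /eqP g_gen.
have g_order : #[g]%g = #|F|.-1 by rewrite orderE -g_gen card_finField_unit.
rewrite -g_order; apply/andP; split; first exact: order_gt0.
apply/forallP => i; rewrite unity_rootE -FinRing.val_unitX.
rewrite -[1]/(val (1%g : {unit F})) val_eqE -order_dvdn; apply/eqP.
apply/idP/eqP => [/dvdn_leq /= le|->]; last exact: dvdnn.
by apply/eqP; rewrite eqn_leq ltn_ord le.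
Qed.

Section Characters.
Variables (F : finFieldType) (K : fieldType) (g : {unit F}) (chi : {unit F} -> K).
Hypothesis g_gen : generator [set: {unit F}] g.
Hypothesis chi_char : mult_character chi.

Lemma mult_characterX u k : chi (u ^+ k)%g = chi u ^+ k.
Proof.
case: chi_char => chi1 chiM; elim: k => [|k IH]; first by rewrite expg0 chi1.
by rewrite expgS exprS chiM IH.
Qed.

Lemma character_order_prim_root n : character_order chi n -> n.-primitive_root (chi g).
Proof.
case=> n0 chi_n chi_min; apply/andP; split=> //; apply/forallP => i.
rewrite unity_rootE; apply/eqP; apply/eqP/eqP => [e|->]; last exact: chi_n.
apply/eqP; rewrite eqn_leq ltn_ord /=; apply: chi_min => // u.
have : u \in <[g]>%g by rewrite -(eqP g_gen) inE.
by case/cycleP => k ->; rewrite mult_characterX exprAC e expr1n.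
Qed.

Lemma jacobi_sum_dlog_char a b :
  jacobi_sum chi a b =
  \sum_x dlog_char (val g) (chi g ^+ a) x * dlog_char (val g) (chi g ^+ b) (1 - x).
Proof.
have gP := prim_root_generator g_gen.
have chiE x c : x != 0 -> chi (to_unit x) ^+ c = dlog_char (val g) (chi g ^+ c) x.
  move=> x0; rewrite /dlog_char (negbTE x0) exprAC -(mult_characterX g); congr (chi _ ^+ _).
  apply: val_inj; rewrite FinRing.val_unitX (dlogK gP x0) /to_unit.
  by rewrite insubdK // -topredE /= unitfE.
rewrite /jacobi_sum big_mkcond; apply: eq_bigr => x _.
have [->|x0] := eqVneq x 0; first by rewrite dlog_char0 mul0r.
have [->|x1] := eqVneq x 1; first by rewrite subrr dlog_char0 mulr0.
by rewrite /= !chiE // subr_eq0 eq_sym.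
Qed.
End Characters.

Theorem theorem9p4 (l f : nat) (F : finFieldType) (g : {unit F})
    (L : fieldExtType rat) (zeta : L) (chi : {unit F} -> L)
    (zetabar xi_l xi_f : {unit F})
    (l_prime : prime l) (f_prime : prime f) (l_neq_f : l <> f)
    (q_mod : #|F| = 1 %[mod l * f])
    (g_gen : generator [set: {unit F}] g)
    (zeta_prim : (l * f)%N.-primitive_root zeta)
    (L_gen : <<1; zeta>>%VS = fullv)
    (chi_char : mult_character chi)
    (chi_ord : character_order chi (l * f))
    (zetabar_def : zetabar = (g ^+ ((#|F| - 1) %/ (l * f)))%g)
    (xi_l_root : (xi_l ^+ l = 1)%g)
    (xi_l_def : (xi_l ^+ f = zetabar ^+ f)%g)
    (xi_f_root : (xi_f ^+ f = 1)%g)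
    (xi_f_def : (xi_f ^+ l = zetabar ^+ l)%g) :
  let pi_l := zeta ^+ f - 1 in
  [<-> exists2 y : L, Zadjoin zeta y & jacobi_sum chi l f + 1 = pi_l ^+ l * y;
       #|F| = 1 %[mod l ^ 2 * f] /\
       (forall i j : nat, (0 <= i <= l - 1)%N -> (1 <= j <= f - 1)%N ->
          1 - val xi_l ^+ i * val xi_f ^+ j \in unit_powers F l);
       #|F| = 1 %[mod l ^ 2 * f] /\
       (forall i j : nat, (0 <= i <= l - 1)%N -> (1 <= j <= f %/ 2)%N ->
          1 - val xi_l ^+ i * val xi_f ^+ j \in unit_powers F l)].
Proof.
move=> pi_l; have {}l_neq_f : l != f by apply/eqP.
have l0 := prime_gt0 l_prime; have f0 := prime_gt0 f_prime.
have co := coprime_lf l_prime f_prime l_neq_f.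
have F0 : (0 < #|F|)%N by apply/card_gt0P; exists 0.
have lf_dvd : (l * f %| #|F|.-1)%N by rewrite -subn1 -eqn_mod_dvd //; apply/eqP.
have g_prim := prim_root_generator g_gen.
set M := (#|F|.-1 %/ (l * f))%N.
have q_mod2 : #|F| = 1 %[mod l ^ 2 * f] <-> (l %| M)%N.
  have -> : (l %| M)%N = (l ^ 2 * f %| #|F|.-1)%N.
    have -> : (l ^ 2 * f = l * (l * f))%N by rewrite expnS expn1 mulnA.
    by rewrite -[X in _ = (_ %| X)%N](divnK lf_dvd) dvdn_pmul2r // muln_gt0 l0.
  by rewrite -subn1 -eqn_mod_dvd //; split=> [/eqP|/eqP].
have xiE i j s : s = i %[mod l] -> s = j %[mod f] ->
    val xi_l ^+ i * val xi_f ^+ j = val g ^+ (M * s).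
  move=> si sj; have vX (u : {unit F}) k : val u ^+ k = val (u ^+ k)%g.
    by rewrite FinRing.val_unitX.
  have xl : val xi_l ^+ l = 1 by rewrite vX xi_l_root.
  have xf : val xi_f ^+ f = 1 by rewrite vX xi_f_root.
  (* The quotient of the two sides has order dividing both [l] and [f]. *)
  have xi_lf : val xi_l * val xi_f = val zetabar.
    have z0 : val zetabar != 0 by rewrite -unitfE (valP zetabar).
    apply: (mulIf (invr_neq0 z0)); rewrite divff //; apply: (expr_coprime_eq1 co).
      by rewrite !exprMn exprVn xl mul1r !vX xi_f_def divff // -vX expf_neq0.
    by rewrite !exprMn exprVn xf mulr1 !vX xi_l_def divff // -vX expf_neq0.
  rewrite -(expr_mod i xl) -(expr_mod j xf) -si -sj !expr_mod // -exprMn exprM.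
  by congr (_ ^+ s); rewrite xi_lf zetabar_def subn1 FinRing.val_unitX.
have chiE := jacobi_sum_dlog_char g_gen chi_char l f.
have chi_prim := character_order_prim_root g_gen chi_char chi_ord.
have cond1 : (exists2 y : L, Zadjoin zeta y & jacobi_sum chi l f + 1 = pi_l ^+ l * y) <->
  (forall i j, (i < l)%N -> (j < f)%N ->
    (l %| jcount (val g) l f i j - jcount (val g) l f i 0%N)%Z).
  rewrite -(jacobi_dvd_jcount g_prim l_prime f_prime l_neq_f lf_dvd chi_prim) -chiE.
  split; [exact: (Zadjoin_prim_root zeta_prim chi_prim)
         | exact: (Zadjoin_prim_root chi_prim zeta_prim)].
have powE i j : (0 <= i <= l - 1)%N -> (1 <= j <= f - 1)%N ->
    (1 - val xi_l ^+ i * val xi_f ^+ j \in unit_powers F l) = (l %| logsum (val g) l f i j)%Z.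
  move=> /andP[_ il] /andP[j0 jf].
  have {}il : (i < l)%N by rewrite -(prednK l0) ltnS -subn1.
  have {}jf : (j < f)%N by rewrite -(prednK f0) ltnS -subn1.
  rewrite (@xiE i j (chinese l f i j)) ?chinese_modl ?chinese_modr //.
  have [nz ->] := logsum_dlog g_prim l_prime f_prime l_neq_f lf_dvd jf j0 il
    (chinese_modl co i j) (chinese_modr co i j).
  by rewrite (mem_unit_powers g_prim (dvd_l lf_dvd) nz).
tfae.
- move=> /cond1 jl; have lM := jcount_dvd_card g_prim l_prime f_prime l_neq_f lf_dvd chi_prim jl.
  split; first exact/q_mod2.
  move=> i j hi hj; rewrite powE //; move: i j hi hj => i j /andP[_ il] jf.
  apply: (proj1 (jcount_logsum g_prim l_prime f_prime l_neq_f lf_dvd lM)) => //.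
    by rewrite -(prednK l0) ltnS -subn1.
  by case/andP: jf => -> /=; rewrite -[X in (_ < X)%N](prednK f0) ltnS -subn1.
- move=> [q2 h]; split=> // i j hi /andP[j1 jf]; apply: h => //; rewrite j1 /=.
  have := prime_gt1 f_prime; move: jf; clear; lia.
move=> [/q_mod2 lM h]; apply/cond1.
apply: (proj2 (jcount_logsum g_prim l_prime f_prime l_neq_f lf_dvd lM)) => i j il jf.
have hi : (0 <= i <= l - 1)%N by clear -il l0; lia.
have hj : (1 <= j <= f - 1)%N by clear -jf f0; lia.
rewrite -powE //; have [j2|j2] := leqP j (f %/ 2).
  by apply: h => //; rewrite j2; case/andP: hj => ->.
(* Inverting the root of unity turns [(i, j)] into [(-i, -j)] and brings [j] into the lower half;
   the remainder modulo [l] keeps [i = 0] in range. *)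
pose i' := ((l - i) %% l)%N; pose j' := (f - j)%N.
have hi' : (0 <= i' <= l - 1)%N by have := ltn_pmod (l - i) l0; rewrite -/i'; clear -l0; lia.
have hj' : (1 <= j' <= f %/ 2)%N.
  by rewrite /j'; clear -jf j2; lia.
pose s := chinese l f i j; pose s' := chinese l f i' j'.
have sl : s = i %[mod l] by apply: chinese_modl.
have sf : s = j %[mod f] by apply: chinese_modr.
have s'l : s' = i' %[mod l] by apply: chinese_modl.
have s'f : s' = j' %[mod f] by apply: chinese_modr.
have ss' : (l * f %| s + s')%N.
  rewrite Gauss_dvd // /dvdn -modnDm sl s'l -[X in X && _]/(_ == 0)%N.
  rewrite modnDm modnDmr subnKC ?modnn //=; last exact: ltnW.
  by rewrite -modnDm sf s'f modnDm subnKC ?modnn // ltnW //; case/andP: jf.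
have := h i' j' hi' hj'; rewrite (xiE _ _ _ s'l s'f) (xiE _ _ _ sl sf).
have [nz _] := logsum_dlog g_prim l_prime f_prime l_neq_f lf_dvd
  (proj2 (andP jf)) (proj1 (andP jf)) il sl sf.
have j'f : (j' < f)%N.
  by rewrite /j'; clear -jf; lia.
have [nz' _] := logsum_dlog g_prim l_prime f_prime l_neq_f lf_dvd
  j'f (proj1 (andP hj')) (ltn_pmod _ l0) s'l s'f.
by rewrite !(mem_unit_powers g_prim (dvd_l lf_dvd)) //
  (dvd_dlog_inv g_prim l_prime lf_dvd lM ss' nz).
Qed.
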